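(* Let $(A,B)$ be controllable and let $\Sigma\in\mathbb{S}^n$ be positive semi-definite. The mapping $\mathcal{D}\to\mathbb{S}^n$, $\lambda\mapsto P_-(\lambda)$ is convex and the mapping $\mathcal{D}\to\mathbb{S}^n$, $\lambda\mapsto P_+(\lambda)$ is concave (with respect to the cone of positive semi-definite matrices). Furthermore, the real-valued mappings $\lambda\mapsto-\log\det P_+(\lambda)$ (on $\{\lambda\in\mathcal{D}: P_+(\lambda)\succ0\}$), $\lambda\mapsto-\log\det\Delta(\lambda)$ (on $\mathcal{D}$), and $\lambda\mapsto-\operatorname{trace}(\Sigma P_+(\lambda))$ (on $\mathcal{D}$) are convex, where $\Delta(\lambda)=P_+(\lambda)-P_-(\lambda)$.
   Context: $\mathbb{S}^n$ is the set of real symmetric $n\times n$ matrices; $\prec,\succ,\preceq,\succeq$ refer to the definiteness order on symmetric matrices. Data: positive integers $n,m,p$; $A\in\mathbb{R}^{n\times n}$, $B\in\mathbb{R}^{n\times m}$, $\Sigma\in\mathbb{S}^n$; and affine matrix-valued functions of $\lambda\in\mathbb{R}^p$, $H(\lambda)=H_0+\sum_{i=1}^p\lambda_iH_i$ for $H\in\{Q,S,R\}$, with $Q_i\in\mathbb{S}^n$, $S_i\in\mathbb{R}^{n\times m}$, $R_i\in\mathbb{S}^m$ for $i=0,\dots,p$. For $\lambda$ with $R(\lambda)$ invertible and $P\in\mathbb{S}^n$ define $$F(P,\lambda)=A^\top P+PA+Q(\lambda)-(PB+S(\lambda))R(\lambda)^{-1}(PB+S(\lambda))^\top .$$ A solution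 $P\in\mathbb{S}^n$ of $F(P,\lambda)=0$ is called anti-stabilizing (resp. stabilizing) if all eigenvalues of $A-BR(\lambda)^{-1}(PB+S(\lambda))^\top$ have positive (resp. negative) real part; each is unique if it exists. $\mathcal{D}$ is the set of all $\lambda\in\mathbb{R}^p$ with $R(\lambda)\prec0$ for which $F(\cdot,\lambda)=0$ has an anti-stabilizing solution. For $\lambda\in\mathcal{D}$, $P_+(\lambda)$ denotes the anti-stabilizing and $P_-(\lambda)$ the stabilizing solution of $F(P,\lambda)=0$ (for $\lambda\in\mathcal{D}$ both exist, and $\Delta(\lambda)\succ0$). A map $G$ from a convex set to $\mathbb{S}^n$ is convex if $G(\alpha\lambda_1+(1-\alpha)\lambda_2)\preceq\alpha G(\lambda_1)+(1-\alpha)G(\lambda_2)$ for all $\lambda_1,\lambda_2$ in its domain and all $\alpha\in[0,1]$, and concave if the same holds with $\succeq$. Convexity (concavity) of a map includes the assertion that its domain is convex. *)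

(* Defs.v *)
From HB Require Import structures.
From mathcomp Require Import all_boot all_order all_algebra.
From mathcomp Require Import sesquilinear complex.
From mathcomp Require Import all_classical all_reals all_analysis.

Set Implicit Arguments.
Unset Strict Implicit.
Unset Printing Implicit Defensive.

Import Order.TTheory GRing.Theory Num.Theory.

Local Open Scope classical_set_scope.
Local Open Scope convex_scope.
Local Open Scope ring_scope.

Definition posdefmx (K : realFieldType) (n : nat) (M : 'M[K]_n) : Prop :=
  M \is symmetricmx /\
  forall x : 'cV[K]_n, x != 0 -> 0 < (x^T *m M *m x) 0 0.

Definition possemidefmx (K : realFieldType) (n : nat) (M : 'M[K]_n) : Prop :=
  M \is symmetricmx /\ forall x : 'cV[K]_n, 0 <= (x^T *m M *m x) 0 0.

Definition negdefmx (K : realFieldType) (n : nat) (M : 'M[K]_n) : Prop :=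
  posdefmx (- M).

Definition loewner_le (K : realFieldType) (n : nat) (M N : 'M[K]_n) : Prop :=
  possemidefmx (N - M).

Definition convex_mxmap (K : realFieldType) (V : lmodType K) (n : nat)
    (D : set (convex_lmodType V)) (G : convex_lmodType V -> 'M[K]_n) : Prop :=
  convex_set D /\
  forall (t : {i01 K}) x y, x \in D -> y \in D ->
    loewner_le (G (x <| t |> y)) (t%:num *: G x + (1 - t%:num) *: G y).

Definition concave_mxmap (K : realFieldType) (V : lmodType K) (n : nat)
    (D : set (convex_lmodType V)) (G : convex_lmodType V -> 'M[K]_n) : Prop :=
  convex_set D /\
  forall (t : {i01 K}) x y, x \in D -> y \in D ->
    loewner_le (t%:num *: G x + (1 - t%:num) *: G y) (G (x <| t |> y)).

(* [convex_function] alone does not assert that the domain is convex. *)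
Definition convex_realmap (K : realFieldType) (V : lmodType K)
    (D : set (convex_lmodType V)) (f : convex_lmodType V -> K) : Prop :=
  convex_set D /\ convex_function D f.

(* Kalman rank condition: [B, A B, ..., A^(n-1) B] has full row rank. *)
Definition controllable (K : fieldType) (n m : nat)
    (A : 'M[K]_n) (B : 'M[K]_(n, m)) : Prop :=
  \rank (\mxrow_(i < n) (A ^+ i *m B)) = n.

(* H ord0 is the constant term and H (lift ord0 i) the coefficient of the
   i-th coordinate of lam. *)
Definition affine_mx (K : pzRingType) (p a b : nat)
    (H : 'I_p.+1 -> 'M[K]_(a, b)) (lam : 'rV[K]_p) : 'M[K]_(a, b) :=
  H ord0 + \sum_(i < p) lam 0 i *: H (lift ord0 i).

Definition riccati (K : comUnitRingType) (n m : nat)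
    (A : 'M[K]_n) (B : 'M[K]_(n, m))
    (Q : 'M[K]_n) (S : 'M[K]_(n, m)) (R : 'M[K]_m) (P : 'M[K]_n) : 'M[K]_n :=
  A^T *m P + P *m A + Q
    - (P *m B + S) *m invmx R *m (P *m B + S)^T.

Definition closed_loop (K : comUnitRingType) (n m : nat)
    (A : 'M[K]_n) (B : 'M[K]_(n, m))
    (S : 'M[K]_(n, m)) (R : 'M[K]_m) (P : 'M[K]_n) : 'M[K]_n :=
  A - B *m invmx R *m (P *m B + S)^T.

Definition complex_eigenvalue (K : rcfType) (n : nat)
    (M : 'M[K]_n) (z : K[i]) : bool :=
  eigenvalue (map_mx (real_complex K) M) z.

Definition antistabilizing (K : rcfType) (n m : nat)
    (A : 'M[K]_n) (B : 'M[K]_(n, m))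
    (Q : 'M[K]_n) (S : 'M[K]_(n, m)) (R : 'M[K]_m) (P : 'M[K]_n) : Prop :=
  [/\ R \in unitmx, P \is symmetricmx, riccati A B Q S R P = 0
    & forall z : K[i],
        complex_eigenvalue (closed_loop A B S R P) z -> 0 < complex.Re z].

Definition stabilizing (K : rcfType) (n m : nat)
    (A : 'M[K]_n) (B : 'M[K]_(n, m))
    (Q : 'M[K]_n) (S : 'M[K]_(n, m)) (R : 'M[K]_m) (P : 'M[K]_n) : Prop :=
  [/\ R \in unitmx, P \is symmetricmx, riccati A B Q S R P = 0
    & forall z : K[i],
        complex_eigenvalue (closed_loop A B S R P) z -> complex.Re z < 0].

Section ParametrizedRiccati.
Context {K : realType} {n m p : nat}.
Context (A : 'M[K]_n) (B : 'M[K]_(n, m)).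
Context (Q : 'I_p.+1 -> 'M[K]_n) (S : 'I_p.+1 -> 'M[K]_(n, m)).
Context (R : 'I_p.+1 -> 'M[K]_m).

Definition riccati_dom : set (convex_lmodType 'rV[K]_p) :=
  [set lam | negdefmx (affine_mx R lam) /\
     exists P, antistabilizing A B
       (affine_mx Q lam) (affine_mx S lam) (affine_mx R lam) P].

(* When a solution of the required kind exists it is unique; the default
   value 0 is taken only when none exists. *)
Definition P_plus (lam : 'rV[K]_p) : 'M[K]_n :=
  xget 0 [set P | antistabilizing A B
    (affine_mx Q lam) (affine_mx S lam) (affine_mx R lam) P].

Definition P_minus (lam : 'rV[K]_p) : 'M[K]_n :=
  xget 0 [set P | stabilizing A B
    (affine_mx Q lam) (affine_mx S lam) (affine_mx R lam) P].

Definition P_gap (lam : 'rV[K]_p) : 'M[K]_n := P_plus lam - P_minus lam.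

End ParametrizedRiccati.

(* Main.v *)
From HB Require Import structures.
Require Import Defs.
From mathcomp Require Import all_boot all_order all_algebra.
From mathcomp Require Import sesquilinear complex ring lra.
From mathcomp Require Import all_classical all_reals all_analysis.

(** Completing the square writes the Riccati operator as
    F(P, lam) = max over K of an expression affine in (P, lam), so F is jointly
    convex and lies above its tangent at P, whose linear part is the Lyapunov
    operator of the closed loop.  Hence P_+ dominates every P with
    F(P, lam) <= 0, and a convex combination of P_+(lam1) and P_+(lam2) is such
    a P at the combined lam: P_+ is concave.  Existence of P_+ at the combined
    parameter comes from perturbing P_+(lam1), P_+(lam2) to strictly feasible
    matrices and minimizing the trace over the matrices with F >= 0 that
    dominate all feasible ones.  P_- is treated by the symmetry
    (A, B, P) -> (-A, -B, -P), and the determinant statements follow from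
    ln det M <= ln det P + tr (P^-1 (M - P)).
    Spectral conditions enter through Lyapunov certificates only: M is called
    expansive if some L > 0 has M^T L + L M > 0, i.e. if all its eigenvalues
    have positive real part. *)

Set Implicit Arguments.
Unset Strict Implicit.
Unset Printing Implicit Defensive.

Import Order.TTheory GRing.Theory Num.Theory.
Import numFieldNormedType.Exports.

Local Open Scope classical_set_scope.
Local Open Scope ring_scope.

(** * Entries, transposes and the Euclidean inner product *)

Section MatrixEntries.
Context {K : pzRingType} {a b : nat}.
Implicit Types M N : 'M[K]_(a, b).

Lemma mxD_E M N i j : (M + N) i j = M i j + N i j.
Proof. by rewrite mxE. Qed.

Lemma mxN_E M i j : (- M) i j = - M i j.
Proof. by rewrite mxE. Qed.

Lemma mxZ_E c M i j : (c *: M) i j = c * M i j.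
Proof. by rewrite mxE. Qed.

Lemma mx0_E i j : (0 : 'M[K]_(a, b)) i j = 0.
Proof. by rewrite mxE. Qed.

Lemma trmx_add M N : (M + N)^T = M^T + N^T.
Proof. exact: linearD. Qed.

Lemma trmx_opp M : (- M)^T = - M^T.
Proof. exact: linearN. Qed.

Lemma trmx_scale c M : (c *: M)^T = c *: M^T.
Proof. exact: linearZ. Qed.

Definition trmx_lin := (trmx_add, trmx_opp, trmx_scale).

Definition mxlinE := (mxD_E, mxN_E, mxZ_E, mx0_E).

End MatrixEntries.

Lemma symmxP (K : realFieldType) n (M : 'M[K]_n) :
  (M \is symmetricmx) <-> M^T = M.
Proof.
rewrite is_hermitianmxE expr0 scale1r map_mx_id //.
by split=> [/eqP|->].
Qed.

Section Dot.
Context {K : realFieldType}.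

Definition dot n (x y : 'cV[K]_n) : K := (x^T *m y) 0 0.

Lemma dotE n (x y : 'cV[K]_n) : dot x y = \sum_i x i 0 * y i 0.
Proof. by rewrite /dot mxE; apply: eq_bigr => i _; rewrite mxE. Qed.

Lemma dotC n (x y : 'cV[K]_n) : dot x y = dot y x.
Proof. by rewrite !dotE; apply: eq_bigr => i _; rewrite mulrC. Qed.

Lemma dotDl n (x y z : 'cV[K]_n) : dot (x + y) z = dot x z + dot y z.
Proof. by rewrite /dot linearD /= mulmxDl mxE. Qed.

Lemma dotDr n (x y z : 'cV[K]_n) : dot z (x + y) = dot z x + dot z y.
Proof. by rewrite /dot mulmxDr mxE. Qed.

Lemma dotNl n (x z : 'cV[K]_n) : dot (- x) z = - dot x z.
Proof. by rewrite /dot linearN /= mulNmx mxE. Qed.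

Lemma dotNr n (x z : 'cV[K]_n) : dot z (- x) = - dot z x.
Proof. by rewrite /dot mulmxN mxE. Qed.

Lemma dotZl n c (x z : 'cV[K]_n) : dot (c *: x) z = c * dot x z.
Proof. by rewrite /dot linearZ /= -scalemxAl mxE. Qed.

Lemma dotZr n c (x z : 'cV[K]_n) : dot z (c *: x) = c * dot z x.
Proof. by rewrite /dot -scalemxAr mxE. Qed.

Lemma dot0l n (z : 'cV[K]_n) : dot 0 z = 0.
Proof. by rewrite /dot trmx0 mul0mx mxE. Qed.

Lemma dot0r n (z : 'cV[K]_n) : dot z 0 = 0.
Proof. by rewrite /dot mulmx0 mxE. Qed.

Definition dot_lin :=
  (dotDl, dotDr, dotNl, dotNr, dotZl, dotZr, dot0l, dot0r).

Lemma dot_adj a b (M : 'M[K]_(a, b)) x y : dot x (M *m y) = dot (M^T *m x) y.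
Proof. by rewrite /dot trmx_mul trmxK mulmxA. Qed.

Lemma dot_ge0 n (x : 'cV[K]_n) : 0 <= dot x x.
Proof. by rewrite dotE; apply: sumr_ge0 => i _; rewrite -expr2 sqr_ge0. Qed.

Lemma dot_eq0 n (x : 'cV[K]_n) : dot x x = 0 -> x = 0.
Proof.
rewrite dotE => /eqP.
rewrite psumr_eq0 => [/allP h|i _]; last by rewrite -expr2 sqr_ge0.
apply/matrixP=> i j; rewrite ord1 mxE.
by have := h i (mem_index_enum i); rewrite -expr2 sqrf_eq0 => /eqP.
Qed.

Lemma dot_gt0 n (x : 'cV[K]_n) : x != 0 -> 0 < dot x x.
Proof.
by move=> x0; rewrite lt_def dot_ge0 andbT; apply: contraNneq x0 => /dot_eq0 ->.
Qed.

End Dot.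

(** * Definite and semidefinite matrices *)

Section Definite.
Context {K : realFieldType}.

Lemma posdefmxP n (M : 'M[K]_n) :
  posdefmx M <-> M^T = M /\ forall x, x != 0 -> 0 < dot x (M *m x).
Proof.
rewrite /posdefmx symmxP /dot.
by split=> -[-> h]; split=> // x /h; rewrite mulmxA.
Qed.

Lemma possemidefmxP n (M : 'M[K]_n) :
  possemidefmx M <-> M^T = M /\ forall x, 0 <= dot x (M *m x).
Proof.
rewrite /possemidefmx symmxP /dot.
by split=> -[-> h]; split=> // x; have := h x; rewrite mulmxA.
Qed.

Lemma posdef_sym n (M : 'M[K]_n) : posdefmx M -> M^T = M.
Proof. by case/posdefmxP. Qed.

Lemma psd_sym n (M : 'M[K]_n) : possemidefmx M -> M^T = M.
Proof. by case/possemidefmxP. Qed.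

Lemma posdef_psd n (M : 'M[K]_n) : posdefmx M -> possemidefmx M.
Proof.
move=> /posdefmxP[sM h]; apply/possemidefmxP; split=> // x.
by have [->|/h/ltW//] := eqVneq x 0; rewrite dot0l.
Qed.

Lemma psdD n (M N : 'M[K]_n) :
  possemidefmx M -> possemidefmx N -> possemidefmx (M + N).
Proof.
move=> /possemidefmxP[sM hM] /possemidefmxP[sN hN]; apply/possemidefmxP.
split=> [|x]; first by rewrite linearD /= sM sN.
by rewrite mulmxDl dotDr addr_ge0.
Qed.

Lemma posdef_psdD n (M N : 'M[K]_n) :
  posdefmx M -> possemidefmx N -> posdefmx (M + N).
Proof.
move=> /posdefmxP[sM hM] /possemidefmxP[sN hN]; apply/posdefmxP.
split=> [|x x0]; first by rewrite linearD /= sM sN.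
by rewrite mulmxDl dotDr ltr_wpDr ?hM.
Qed.

Lemma psd0 n : possemidefmx (0 : 'M[K]_n).
Proof.
apply/possemidefmxP; split=> [|x]; first exact: trmx0.
by rewrite mul0mx dot0r.
Qed.

Lemma psdZ n c (M : 'M[K]_n) :
  0 <= c -> possemidefmx M -> possemidefmx (c *: M).
Proof.
move=> c0 /possemidefmxP[sM hM]; apply/possemidefmxP.
split=> [|x]; first by rewrite linearZ /= sM.
by rewrite -scalemxAl dotZr mulr_ge0.
Qed.

Lemma posdefZ n c (M : 'M[K]_n) : 0 < c -> posdefmx M -> posdefmx (c *: M).
Proof.
move=> c0 /posdefmxP[sM hM]; apply/posdefmxP.
split=> [|x x0]; first by rewrite linearZ /= sM.
by rewrite -scalemxAl dotZr mulr_gt0 ?hM.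
Qed.

Lemma posdef1 n : posdefmx (1%:M : 'M[K]_n).
Proof.
apply/posdefmxP; split=> [|x x0]; first exact: trmx1.
by rewrite mul1mx dot_gt0.
Qed.

Lemma psd_congr a b (M : 'M[K]_a) (N : 'M[K]_(a, b)) :
  possemidefmx M -> possemidefmx (N^T *m M *m N).
Proof.
move=> /possemidefmxP[sM hM]; apply/possemidefmxP.
split=> [|x]; first by rewrite !trmx_mul trmxK sM mulmxA.
by rewrite -!mulmxA dot_adj trmxK.
Qed.

Lemma posdef_congr a b (M : 'M[K]_a) (N : 'M[K]_(a, b)) :
  (forall x : 'cV_b, N *m x = 0 -> x = 0) ->
  posdefmx M -> posdefmx (N^T *m M *m N).
Proof.
move=> Ninj /posdefmxP[sM hM]; apply/posdefmxP.
split=> [|x x0]; first by rewrite !trmx_mul trmxK sM mulmxA.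
rewrite -!mulmxA dot_adj trmxK hM //.
by apply: contraNneq x0 => /Ninj ->.
Qed.

(** With [w = M x], the form at [x + t w] equals [2 t |w|^2 + t^2 w^T M w], which a small negative
    [t] would make negative unless [w = 0]. *)
Lemma psd_ker n (M : 'M[K]_n) x :
  possemidefmx M -> dot x (M *m x) = 0 -> M *m x = 0.
Proof.
move=> /possemidefmxP[sM hM] x0; apply: dot_eq0.
set w := M *m x; set d := dot w w.
have hq t : 0 <= t * (2 * d) + t ^+ 2 * dot w (M *m w).
  have := hM (x + t *: w).
  rewrite mulmxDr -scalemxAr !dot_lin x0 (dot_adj M x) sM -/w -/d; lra.
have [|d0] := eqVneq d 0 => //.
have d_gt0 : 0 < d by rewrite lt_def d0 dot_ge0.
have e0 := hM w; set e := dot w (M *m w) in hq e0.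
have s0 : 0 < e + d by rewrite ltr_wpDl.
(* Minimizing over [t] suggests [- d / e]; the denominator [e + d] stays positive even when
   [e = 0]. *)
have := hq (- d / (e + d)).
suff -> : - d / (e + d) * (2 * d) + (- d / (e + d)) ^+ 2 * e =
          - (d ^+ 2 * (e + 2 * d) / (e + d) ^+ 2).
  rewrite oppr_ge0 leNgt divr_gt0 ?mulr_gt0 ?exprn_gt0 //.
  by rewrite ltr_wpDl ?mulr_gt0.
by field; rewrite gt_eqF.
Qed.

Lemma psd_antisym n (M : 'M[K]_n) :
  possemidefmx M -> possemidefmx (- M) -> M = 0.
Proof.
move=> pM /possemidefmxP[_ hN]; apply/matrixP=> i j.
have h (x : 'cV_n) : M *m x = 0.
  apply: psd_ker => //; apply/eqP; rewrite eq_le.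
  by have := hN x; rewrite mulNmx dotNr oppr_ge0 => ->; have /possemidefmxP[_ ->] := pM.
have := congr1 (fun X : 'cV_n => X i 0) (h (delta_mx j 0)).
by rewrite -colE !mxE.
Qed.

Lemma posdef_inj n (M : 'M[K]_n) (x : 'cV_n) : posdefmx M -> M *m x = 0 -> x = 0.
Proof.
move=> /posdefmxP[_ h] Mx; apply/eqP; apply: contraT => /h.
by rewrite Mx dot0r ltxx.
Qed.

Lemma unitmx_inj n (M : 'M[K]_n) :
  (forall x : 'cV_n, M *m x = 0 -> x = 0) -> M \in unitmx.
Proof.
move=> h; rewrite -unitmx_tr -row_free_unit -kermx_eq0.
apply/eqP/row_matrixP=> i; rewrite row0; apply: trmx_inj.
rewrite trmx0; apply: h; rewrite -{1}(trmxK M) -trmx_mul.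
by rewrite -row_mul mulmx_ker row0 trmx0.
Qed.

Lemma posdef_unit n (M : 'M[K]_n) : posdefmx M -> M \in unitmx.
Proof. by move=> pM; apply: unitmx_inj => x; apply: posdef_inj. Qed.

Lemma posdef_inv n (M : 'M[K]_n) : posdefmx M -> posdefmx (invmx M).
Proof.
move=> pM; have uM := posdef_unit pM; have sM := posdef_sym pM.
suff -> : invmx M = (invmx M)^T *m M *m invmx M.
  by apply: posdef_congr => // x /(congr1 (mulmx M)); rewrite mulKVmx // mulmx0.
by rewrite trmx_inv sM mulVmx // mul1mx.
Qed.

End Definite.

(** * Continuity, compactness and the Rayleigh quotient *)

Section EntrywiseContinuity.
Context {K : realType} {T : topologicalType}.

(** Continuity is taken entry by entry, so that matrix products reduce to sums and products of real
    continuous functions. *)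
Definition mx_continuous a b (f : T -> 'M[K]_(a, b)) :=
  forall i j, continuous (fun u => f u i j).

Lemma continuous_sum_ord k (F : 'I_k -> T -> K) :
  (forall i, continuous (F i)) -> continuous (fun u => \sum_i F i u).
Proof.
move=> cF; have -> : (fun u => \sum_i F i u) = \sum_i F i.
  by apply/funext=> u; rewrite fct_sumE.
apply: (big_ind (fun f : T -> K => continuous f)) => //.
- by move=> u; exact: cst_continuous.
- by move=> f g cf cg u; exact: (continuousD (cf u) (cg u)).
Qed.

Lemma mx_continuous_cst a b (M : 'M[K]_(a, b)) : mx_continuous (fun=> M).
Proof. by move=> i j u; exact: cst_continuous. Qed.

Lemma mx_continuousD a b (f g : T -> 'M[K]_(a, b)) :
  mx_continuous f -> mx_continuous g -> mx_continuous (fun u => f u + g u).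
Proof.
move=> cf cg i j; under [X in continuous X]eq_fun do rewrite mxE.
by move=> u; exact: (continuousD (cf i j u) (cg i j u)).
Qed.

Lemma mx_continuousN a b (f : T -> 'M[K]_(a, b)) :
  mx_continuous f -> mx_continuous (fun u => - f u).
Proof.
move=> cf i j; under [X in continuous X]eq_fun do rewrite mxE.
by move=> u; exact: (continuousN (cf i j u)).
Qed.

Lemma mx_continuousM a b c (f : T -> 'M[K]_(a, b)) (g : T -> 'M[K]_(b, c)) :
  mx_continuous f -> mx_continuous g -> mx_continuous (fun u => f u *m g u).
Proof.
move=> cf cg i j; under [X in continuous X]eq_fun do rewrite mxE.
apply: continuous_sum_ord => k u; exact: (continuousM (cf i k u) (cg k j u)).
Qed.

Lemma mx_continuous_tr a b (f : T -> 'M[K]_(a, b)) :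
  mx_continuous f -> mx_continuous (fun u => (f u)^T).
Proof.
by move=> cf i j; under [X in continuous X]eq_fun do rewrite mxE; exact: cf.
Qed.

Lemma continuous_dot n (f g : T -> 'cV[K]_n) :
  mx_continuous f -> mx_continuous g -> continuous (fun u => dot (f u) (g u)).
Proof.
move=> cf cg; apply: (@mx_continuousM 1 n 1 (fun u => (f u)^T) g) => //.
exact: mx_continuous_tr.
Qed.

End EntrywiseContinuity.

Lemma mx_continuous_rV (K : realType) n :
  mx_continuous (fun v : 'rV[K]_n => v).
Proof. by move=> i j u; exact: coord_continuous. Qed.

(** Row vectors are the setting of the extreme value theorem [EVT_min_rV]; square matrices are later
    brought into it by [vec_mx]. *)
Lemma compact_box (K : realType) n (c : K) (A : set 'rV[K]_n) :
  (forall v, A v -> forall i, `|v 0 i| <= c) -> closed A -> compact A.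
Proof.
move=> hA cA.
apply: (@subclosed_compact _ _ [set v : 'rV[K]_n | forall i, `[- c, c]%classic (v 0 i)]).
- exact: cA.
- by apply: (@rV_compact _ _ (fun=> `[- c, c]%classic)) => i; exact: segment_compact.
- by move=> v Av i; rewrite /= in_itv /= -ler_norml; exact: hA.
Qed.

(* The minimum of the generalized Rayleigh quotient of the pencil (Z, L). *)
Lemma rayleigh_min (K : realType) n (Z L : 'M[K]_n) :
  (0 < n)%N -> Z^T = Z -> posdefmx L ->
  exists mu (v : 'cV[K]_n),
    [/\ v != 0, possemidefmx (Z - mu *: L) & Z *m v = mu *: (L *m v)].
Proof.
move=> n0 sZ pL; have [sL hL] := (posdefmxP _).1 pL.
pose A := [set v : 'rV[K]_n | dot v^T v^T = 1].
pose q (M : 'M[K]_n) (v : 'rV[K]_n) := dot v^T (M *m v^T).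
have ctr : mx_continuous (fun v : 'rV[K]_n => v^T).
  by apply: mx_continuous_tr; exact: mx_continuous_rV.
have cq M : continuous (q M).
  apply: continuous_dot => //; apply: mx_continuousM => //.
  exact: mx_continuous_cst.
have A_neq0 v : A v -> v^T != 0.
  by move=> Av; apply: contra_eq_neq Av => ->; rewrite dot0l eq_sym oner_eq0.
have cA : compact A.
  apply: (@compact_box _ _ 1) => [v Av i|].
    rewrite -(@ler_pXn2r _ 2) ?nnegrE // expr1n real_normK ?num_real //.
    have <- : dot v^T v^T = 1 := Av.
    rewrite dotE (bigD1 i) //= mxE -expr2 lerDl.
    by apply: sumr_ge0 => k _; rewrite mxE -expr2 sqr_ge0.
  have -> : A = (fun v : 'rV[K]_n => dot v^T v^T) @^-1` [set 1] by [].
  apply: preimage_closed; last exact: closed_eq.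
  by move=> v _; exact: continuous_dot.
have A0 : A !=set0.
  exists (delta_mx 0 (Ordinal n0)).
  rewrite /A /= trmx_delta dotE (bigD1 (Ordinal n0)) //= big1 => [|i /negPf hi].
    by rewrite mxE !eqxx mulr1 addr0.
  by rewrite mxE hi mulr0.
have cf : {within A, continuous (fun v => q Z v / q L v)}.
  apply: continuous_in_subspaceT => v /set_mem Av.
  apply: continuousM; first exact: cq.
  by apply: continuousV; [rewrite gt_eqF // hL // A_neq0|exact: cq].
have [v /set_mem Av vmin] := EVT_min_rV A0 cA cf.
have v0 := A_neq0 _ Av.
set mu := q Z v / q L v in vmin.
have hmu : possemidefmx (Z - mu *: L).
  apply/possemidefmxP; split; first by rewrite linearB linearZ /= sZ sL.
  move=> x; have [->|x0] := eqVneq x 0; first by rewrite dot0l.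
  rewrite mulmxBl -scalemxAl !dot_lin subr_ge0 -ler_pdivlMr ?hL //.
  set s := Num.sqrt (dot x x).
  have s0 : 0 < s by rewrite sqrtr_gt0 dot_gt0.
  have s2 : s ^+ 2 = dot x x by rewrite sqr_sqrtr // dot_ge0.
  have Ax : A (s^-1 *: x^T).
    rewrite /A /= linearZ /= trmxK !dot_lin -s2; field; exact: lt0r_neq0.
  have := vmin _ (mem_set Ax).
  rewrite /q linearZ /= trmxK -!scalemxAr !dot_lin.
  congr (_ <= _); field.
  by rewrite !gt_eqF // hL.
exists mu, v^T; split=> //.
(* The semidefinite form [Z - mu L] vanishes at the minimizer, which therefore lies in its kernel;
   no derivative of the quotient is taken. *)
apply/eqP; rewrite -subr_eq0 scalemxAl -mulmxBl; apply/eqP; apply: psd_ker => //.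
rewrite mulmxBl -scalemxAl !dot_lin /mu /q; field.
by rewrite gt_eqF // hL.
Qed.

(** * The Lyapunov operator and expansive matrices *)

Definition lyap (K : pzRingType) n (M X : 'M[K]_n) : 'M[K]_n :=
  M^T *m X + X *m M.

Lemma lyap_sym (K : comPzRingType) n (M X : 'M[K]_n) :
  X^T = X -> (lyap M X)^T = lyap M X.
Proof. by move=> sX; rewrite /lyap linearD /= !trmx_mul sX trmxK addrC. Qed.

Definition expansive (K : realFieldType) n (M : 'M[K]_n) : Prop :=
  exists L, posdefmx L /\ posdefmx (lyap M L).

Section Lyapunov.
Context {K : realType}.

Lemma lyapD n (M X Y : 'M[K]_n) : lyap M (X + Y) = lyap M X + lyap M Y.
Proof. by rewrite /lyap mulmxDr mulmxDl addrACA. Qed.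

Lemma lyapN n (M X : 'M[K]_n) : lyap M (- X) = - lyap M X.
Proof. by rewrite /lyap mulmxN mulNmx opprD. Qed.

Lemma lyapZ n c (M X : 'M[K]_n) : lyap M (c *: X) = c *: lyap M X.
Proof. by rewrite /lyap -scalemxAr -scalemxAl scalerDr. Qed.

Lemma lyap_shift n c (M X : 'M[K]_n) :
  lyap (M + c%:M) X = lyap M X + (2 * c) *: X.
Proof.
rewrite /lyap linearD /= tr_scalar_mx mulmxDl mulmxDr mul_scalar_mx mul_mx_scalar.
by rewrite addrACA -scalerDl; congr (_ + _ *: _); ring.
Qed.

Lemma dot_lyap n (M X : 'M[K]_n) x :
  X^T = X -> dot x (lyap M X *m x) = 2 * dot (X *m x) (M *m x).
Proof.
move=> sX; rewrite /lyap mulmxDl dotDr -!mulmxA dot_adj trmxK dotC.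
by rewrite (dot_adj X) sX; ring.
Qed.

Lemma psd_posdef n (M : 'M[K]_n) :
  possemidefmx M -> (forall x : 'cV_n, M *m x = 0 -> x = 0) -> posdefmx M.
Proof.
move=> pM inj; apply/posdefmxP; split=> [|x]; first exact: psd_sym.
have /possemidefmxP[_ h] := pM.
by rewrite lt_def h andbT; apply: contra_neq => /(psd_ker pM)/inj.
Qed.

Lemma cV0_eq0 (x : 'cV[K]_0) : x = 0.
Proof. by apply/matrixP=> -[]. Qed.

Lemma psd_dim0 (M : 'M[K]_0) : possemidefmx M.
Proof.
apply/possemidefmxP; split=> [|x]; first by apply/matrixP=> -[].
by rewrite (cV0_eq0 x) dot0l.
Qed.

(** If [mu] is the least generalized eigenvalue of [X] relative to [E], then
    [E + e X = (1 + e mu) E + e (X - mu E)], and [e <= 1 / (1 + |mu|)] keeps [1 + e mu] positive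
    when [e > 0]. Dimension 0 is separate because the Rayleigh quotient needs a nonzero vector. *)
Lemma posdef_perturb n (E X : 'M[K]_n) :
  posdefmx E -> X^T = X ->
  exists2 eps, 0 < eps & forall e, 0 <= e <= eps -> posdefmx (E + e *: X).
Proof.
case: n E X => [|n] E X pE sX.
  exists 1 => // e _; apply: psd_posdef; first exact: psd_dim0.
  by move=> x _; exact: cV0_eq0.
have [mu [_ [_ h _]]] := rayleigh_min (ltn0Sn n) sX pE.
exists (1 + `|mu|)^-1 => [|e /andP[e0]]; first by rewrite invr_gt0 ltr_wpDr.
rewrite -div1r ler_pdivlMr ?ltr_wpDr // => e1.
have -> : E + e *: X = (1 + e * mu) *: E + e *: (X - mu *: E).
  by apply/matrixP=> i j; rewrite !mxlinE; ring.
apply: posdef_psdD; last exact: psdZ.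
have [->|en0] := eqVneq e 0; first by rewrite mul0r addr0 scale1r.
apply: posdefZ => //; have := ler_norm (- mu); rewrite normrN => h1.
have : 0 < e by rewrite lt_def en0.
by nra.
Qed.

(** Let [L] certify that [M] is expansive and let [(mu, v)] be the least generalized eigenpair of
    [(X, L)]. Then [v^T lyap(M, X) v = mu v^T lyap(M, L) v] forces [mu >= 0], and
    [X = (X - mu L) + mu L] is a sum of semidefinite matrices. *)
Lemma lyap_psd n (M X : 'M[K]_n) :
  expansive M -> X^T = X -> possemidefmx (lyap M X) -> possemidefmx X.
Proof.
case: n M X => [|n] M X; first by move=> *; exact: psd_dim0.
move=> [L [pL pML]] sX pMX.
have [mu [v [v0 h eX]]] := rayleigh_min (ltn0Sn n) sX pL.
suff mu0 : 0 <= mu.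
  by rewrite -(subrK (mu *: L) X); apply: psdD => //; apply/psdZ/posdef_psd.
have /possemidefmxP[_ /(_ v)] := pMX.
rewrite dot_lyap // eX dotZl mulrCA -dot_lyap ?posdef_sym //.
by rewrite pmulr_lge0 //; have /posdefmxP[_ ->] := pML.
Qed.

Lemma lyap_ker n (M X : 'M[K]_n) (x : 'cV_n) :
  X^T = X -> posdefmx (lyap M X) -> X *m x = 0 -> x = 0.
Proof.
move=> sX /posdefmxP[_ h] Xx; apply/eqP; apply: contraT => /h.
by rewrite dot_lyap // Xx dot0l mulr0 ltxx.
Qed.

Lemma lyap_posdef n (M X : 'M[K]_n) :
  expansive M -> X^T = X -> posdefmx (lyap M X) -> posdefmx X.
Proof.
move=> eM sX pMX; apply: psd_posdef => [|x]; last exact: (lyap_ker sX pMX).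
exact: lyap_psd (posdef_psd pMX).
Qed.

Lemma expansive_shift n (M : 'M[K]_n) c :
  expansive M -> 0 <= c -> expansive (M + c%:M).
Proof.
move=> [L [pL pML]] c0; exists L; split=> //.
rewrite lyap_shift; apply: posdef_psdD => //.
by apply: psdZ; [rewrite mulr_ge0|exact: posdef_psd].
Qed.

Lemma expansive_shift_large n (M : 'M[K]_n) :
  exists2 c, 0 < c & expansive (M + c%:M).
Proof.
have s1 : (lyap M 1%:M)^T = lyap M 1%:M by apply: lyap_sym; exact: trmx1.
have [e e0 he] := posdef_perturb (posdef1 n) s1.
(* With the identity as certificate, this shift makes the Lyapunov matrix a positive multiple of a
   small perturbation of the identity. *)
exists (2 * e)^-1; first by rewrite invr_gt0 mulr_gt0.
exists 1%:M; split; first exact: posdef1.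
have -> : lyap (M + (2 * e)^-1%:M) 1%:M = e^-1 *: (1%:M + e *: lyap M 1%:M).
  rewrite lyap_shift scalerDr scalerA mulVf ?gt_eqF // scale1r addrC.
  by congr (_ *: _ + _); field; rewrite gt_eqF.
by apply: posdefZ; [rewrite invr_gt0|apply: he; rewrite lexx ltW].
Qed.

(* Acts as [2 lyap M] on symmetric matrices and, up to [lyap], as twice the
   identity on skew ones: it is invertible iff [lyap M] is invertible on
   symmetric matrices. *)
Definition lyap_ext n (M Z : 'M[K]_n) : 'M[K]_n :=
  lyap M (Z + Z^T) + (Z - Z^T).

Lemma lyap_ext_linear n (M : 'M[K]_n) : linear (lyap_ext M).
Proof.
move=> c X Y; rewrite /lyap_ext !linearP /=.
have -> : c *: X + Y + (c *: X^T + Y^T) = c *: (X + X^T) + (Y + Y^T).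
  by rewrite scalerDr addrACA.
rewrite [lyap M (c *: _ + _)]lyapD lyapZ; apply/matrixP=> i j; rewrite !mxlinE; ring.
Qed.

HB.instance Definition _ n (M : 'M[K]_n) :=
  GRing.isLinear.Build K 'M[K]_n 'M[K]_n _ (lyap_ext M) (lyap_ext_linear M).

(** The skew part of [lyap_ext M Z] is exactly [Z - Z^T], because [lyap M] keeps the symmetric
    matrix [Z + Z^T] symmetric. *)
Lemma lyap_ext_sym n (M Z : 'M[K]_n) :
  (lyap_ext M Z)^T = lyap_ext M Z -> Z^T = Z.
Proof.
have sS : (Z + Z^T)^T = Z + Z^T by rewrite linearD /= trmxK addrC.
rewrite /lyap_ext linearD linearB /= trmxK lyap_sym // => /addrI h.
apply/matrixP=> i j; have := congr1 (fun A : 'M[K]_n => A i j) h.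
by rewrite !mxE; lra.
Qed.

(** The linear alternative for [lyap_ext M], written as a square matrix by [lin_mx]. Preimages of
    symmetric matrices, kernel elements included, are symmetric, so both cases descend to
    [lyap M]. *)
Lemma lyap_dichotomy n (M : 'M[K]_n) :
  (exists Z, [/\ Z^T = Z, Z != 0 & lyap M Z = 0]) \/
  (forall E, E^T = E -> exists2 X, X^T = X & lyap M X = E).
Proof.
pose g := lin_mx (lyap_ext M).
have [gU|gN] := boolP (row_free g); [right => E sE|left].
  have uG : g \in unitmx by rewrite -row_free_unit.
  pose Z := vec_mx (mxvec E *m invmx g).
  have eZ : lyap_ext M Z = E.
    apply: (can_inj mxvecK); rewrite -mul_vec_lin vec_mxK.
    by rewrite mulmxKV.
  have sZ : Z^T = Z by apply: (@lyap_ext_sym _ M); rewrite eZ.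
  exists (Z + Z); first by rewrite linearD /= sZ.
  by rewrite -eZ /lyap_ext sZ subrr addr0.
move: gN; rewrite -kermx_eq0 => /rowV0Pn[v /sub_kermxP vg v0].
pose Z : 'M[K]_n := vec_mx v.
have eZ : lyap_ext M Z = 0.
  by apply: (can_inj mxvecK); rewrite -mul_vec_lin vec_mxK vg linear0.
have sZ : Z^T = Z by apply: (@lyap_ext_sym _ M); rewrite eZ trmx0.
exists Z; split=> //.
  by apply: contra_neq v0 => Z0; rewrite -[v]vec_mxK -/Z Z0 linear0.
move: eZ; rewrite /lyap_ext sZ subrr addr0 lyapD -mulr2n -scaler_nat => /eqP.
by rewrite scaler_eq0 pnatr_eq0 /= => /eqP.
Qed.

(** For a symmetric kernel element [Z], both [Z] and [- Z] would be semidefinite by [lyap_psd], so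
    [Z = 0] and the solvable alternative remains. *)
Lemma lyap_solve n (M E : 'M[K]_n) :
  expansive M -> E^T = E -> exists2 X, X^T = X & lyap M X = E.
Proof.
move=> eM; have [[Z [sZ Z0 MZ]]|] := lyap_dichotomy M; last exact.
case/eqP: Z0; apply: psd_antisym; apply: (lyap_psd eM).
- by [].
- by rewrite MZ; exact: psd0.
- by rewrite linearN /= sZ.
- by rewrite lyapN MZ oppr0; exact: psd0.
Qed.

End Lyapunov.

(** * Expansive matrices and real parts of eigenvalues *)

(* The row space and the left kernel of [Z] are stable: the eigenvalues of [N]
   on the former are opposite to those of [N^T] on the quotient by the latter. *)
Lemma lyap_ker_opp_eigenvalues (C : numClosedFieldType) n (N Z : 'M[C]_n) :
  lyap N Z = 0 -> Z != 0 -> exists2 z, eigenvalue N z & eigenvalue N (- z).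
Proof.
rewrite /lyap => /eqP; rewrite addr_eq0 => /eqP hZ Z0.
have r0 : (0 < \rank Z)%N by rewrite lt0n mxrank_eq0.
have WZ : (row_base Z <= Z)%MS by rewrite eq_row_base.
have ZW : (Z <= row_base Z)%MS by rewrite eq_row_base.
have WN : (row_base Z *m N <= row_base Z)%MS.
  apply: submx_trans (submxMr N WZ) _; apply: submx_trans ZW.
  by rewrite -[Z *m N]opprK -hZ -mulNmx submxMl.
(* [T] is the matrix of [N] restricted to the row space of [Z]; its eigenvalues are eigenvalues of
   [N]. *)
have [T hT] := submxP WN.
have [z /eigenvalueP[w wT w0]] := eigenvalue_closed T r0.
have [u hu] : exists u, w *m row_base Z = u *m Z.
  by apply/submxP; exact: submx_trans (submxMl _ _) WZ.
have v0 : w *m row_base Z != 0.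
  by apply: contra_neq w0 => /eqP; rewrite mulmx_free_eq0 ?row_base_free // => /eqP.
have vN : u *m Z *m N = z *: (u *m Z).
  by rewrite -hu -mulmxA hT mulmxA wT -scalemxAl.
exists z; first by apply/eigenvalueP; exists (u *m Z); rewrite // -hu.
(* If [- z] were not an eigenvalue, [G = N^T + z] would be invertible and, by equality of ranks,
   would map the left kernel of [Z] onto itself. Since [u G Z = u Z (z - N) = 0], the vector [u]
   would lie in that kernel, against [u Z != 0]. *)
apply: contraT => hz.
pose G := N^T + z%:M.
have uG : G \in unitmx.
  rewrite -unitmx_tr -row_free_unit -kermx_eq0 linearD /= trmxK tr_scalar_mx.
  by move: hz; rewrite negbK /eigenspace raddfN /= opprK.
have GZ : G *m Z = Z *m (z%:M - N).
  by rewrite mulmxDl hZ mulmxBr mul_scalar_mx mul_mx_scalar addrC.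
have kG : (kermx Z *m G <= kermx Z)%MS.
  by apply/sub_kermxP; rewrite -mulmxA GZ mulmxA mulmx_ker mul0mx.
have kerG : (kermx Z <= kermx Z *m G)%MS.
  have := mxrank_leqif_sup kG.
  by rewrite mxrankMfree ?row_free_unit // => -[_ <-].
have : (u *m G <= kermx Z *m G)%MS.
  apply: submx_trans kerG; apply/sub_kermxP.
  by rewrite -mulmxA GZ mulmxA mulmxBr vN mul_mx_scalar subrr.
rewrite submxMfree ?row_free_unit // => /sub_kermxP uZ.
by move: v0; rewrite hu uZ eqxx.
Qed.

Section ExpansiveSpectrum.
Context {K : realType}.

Lemma complex_eigenvalue_parts n (M : 'M[K]_n) (z : K[i]) :
  complex_eigenvalue M z ->
  exists x y : 'rV[K]_n, [/\ (x != 0) || (y != 0),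
    x *m M = complex.Re z *: x - complex.Im z *: y &
    y *m M = complex.Im z *: x + complex.Re z *: y].
Proof.
move=> /eigenvalueP[v vM v0].
have ReD : {morph @complex.Re K : a b / a + b} by move=> [? ?] [? ?].
have ImD : {morph @complex.Im K : a b / a + b} by move=> [? ?] [? ?].
have ReM (a : K[i]) (c : K) : complex.Re (a * (real_complex K c)) = complex.Re a * c.
  by case: a => a b /=; ring.
have ImM (a : K[i]) (c : K) : complex.Im (a * (real_complex K c)) = complex.Im a * c.
  by case: a => a b /=; ring.
have hv j : \sum_k v 0 k * (real_complex K (M k j)) = z * v 0 j.
  have := congr1 (fun w : 'rV[K[i]]_n => w 0 j) vM; rewrite !mxE => <-.
  by apply: eq_bigr => k _; rewrite mxE.
exists (map_mx (@complex.Re K) v), (map_mx (@complex.Im K) v); split.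
- apply: contraR v0; rewrite negb_or !negbK => /andP[/eqP x0 /eqP y0].
  apply/eqP/matrixP=> i j; rewrite mxE.
  have := congr1 (fun w : 'rV[K]_n => w i j) x0.
  have := congr1 (fun w : 'rV[K]_n => w i j) y0.
  by rewrite !mxE; case: (v i j) => a b /= -> ->.
- apply/rowP=> j; rewrite !mxE; under eq_bigr => k _ do rewrite mxE -ReM.
  rewrite -(big_morph _ ReD (erefl : complex.Re (0 : K[i]) = 0)) hv.
  by case: z {hv vM} => a b; case: (v 0 j) => c d /=.
- apply/rowP=> j; rewrite !mxE; under eq_bigr => k _ do rewrite mxE -ImM.
  rewrite -(big_morph _ ImD (erefl : complex.Im (0 : K[i]) = 0)) hv.
  by case: z {hv vM} => a b; case: (v 0 j) => c d /=; ring.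
Qed.

(** For a left eigenvector [x + i y] and [N = L^-1], the sum of the forms of [lyap M^T N] at [x] and
    [y] is [2 Re z] times the sum of the forms of [N]; the terms in [Im z] cancel by symmetry of
    [N]. *)
Lemma expansive_eigenvalue n (M : 'M[K]_n) z :
  expansive M -> complex_eigenvalue M z -> 0 < complex.Re z.
Proof.
move=> [L [pL pML]] /complex_eigenvalue_parts[x [y [xy0 hx hy]]].
set a := complex.Re z in hx hy *; set b := complex.Im z in hx hy.
have uL := posdef_unit pL; have pN := posdef_inv pL.
set N := invmx L in pN.
have sN := posdef_sym pN.
(* Eigenvectors are row vectors, so a certificate for [M^T] is required; the inverse of [L] is one,
   by congruence. *)
have pMN : posdefmx (lyap M^T N).
  have -> : lyap M^T N = N^T *m lyap M L *m N.
    rewrite sN /lyap trmxK mulmxDr mulmxDl !mulmxA mulVmx // mul1mx.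
    by rewrite -(mulmxA _ L) mulmxV // mulmx1 addrC.
  by apply: posdef_congr => // w; exact: posdef_inj.
have e1 : M^T *m x^T = a *: x^T - b *: y^T.
  by rewrite -trmx_mul hx linearB /= !linearZ.
have e2 : M^T *m y^T = b *: x^T + a *: y^T.
  by rewrite -trmx_mul hy linearD /= !linearZ.
have [_ hN] := (posdefmxP _).1 pN; have [_ hMN] := (posdefmxP _).1 pMN.
have t0 (w : 'rV[K]_n) : w != 0 -> w^T != 0.
  by apply: contra_neq => w0; rewrite -[w]trmxK w0 trmx0.
have [/possemidefmxP[_ pN'] /possemidefmxP[_ pMN']] :=
  (posdef_psd pN, posdef_psd pMN).
have s1 : 0 < a * (dot (N *m x^T) x^T + dot (N *m y^T) y^T).
  have -> : a * (dot (N *m x^T) x^T + dot (N *m y^T) y^T) =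
    2^-1 * (dot x^T (lyap M^T N *m x^T) + dot y^T (lyap M^T N *m y^T)).
    rewrite !dot_lyap // e1 e2 !dot_lin (dotC (N *m y^T) x^T) dot_adj sN.
    by field.
  rewrite pmulr_rgt0 ?invr_gt0 //.
  by case/orP: xy0 => /t0/hMN ?; [rewrite ltr_pwDl|rewrite ltr_wpDl].
rewrite -(pmulr_lgt0 a (x := dot (N *m x^T) x^T + dot (N *m y^T) y^T)) //.
rewrite !(dotC (N *m _)).
by case/orP: xy0 => /t0/hN ?; [rewrite ltr_pwDl|rewrite ltr_wpDl].
Qed.

Lemma complex_eigenvalue_shift n (M : 'M[K]_n) s z :
  eigenvalue (map_mx (real_complex K) (M + s%:M)) z ->
  complex_eigenvalue M (z - real_complex K s).
Proof.
move=> /eigenvalueP[v vM v0]; apply/eigenvalueP; exists v => //.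
move: vM; rewrite map_mxD /= map_scalar_mx mulmxDr mul_mx_scalar => vM.
by rewrite scalerBl -vM addrK.
Qed.

(* Let s be the least shift beyond which M + s is expansive. At M + s the
   Lyapunov operator must be singular, which produces an eigenvalue of M with
   real part at most -s. *)
Lemma eigenvalue_expansive n (M : 'M[K]_n) :
  (forall z, complex_eigenvalue M z -> 0 < complex.Re z) -> expansive M.
Proof.
move=> hM; apply: contrapT => nM.
pose E := [set s : K | 0 <= s /\ expansive (M + s%:M)].
have E0 : E !=set0.
  by have [c c0 ec] := expansive_shift_large M; exists c; split=> //; exact: ltW.
have Elb : lbound E 0 by move=> s [].
have hasE : has_inf E by split=> //; exists 0.
pose s := inf E.
have s0 : 0 <= s by exact: lb_le_inf.
have shiftD a b : M + a%:M + b%:M = M + (a + b)%:M.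
  by rewrite -addrA -raddfD.
have hA e : 0 < e -> expansive (M + s%:M + e%:M).
  move=> e0; have [r [r0 er] rs] := inf_adherent e0 hasE.
  have -> : M + s%:M + e%:M = M + r%:M + (s + e - r)%:M.
    by rewrite !shiftD; congr (_ + _%:M); ring.
  by apply: expansive_shift => //; rewrite subr_ge0 ltW.
(* Expansiveness is an open condition: if it held at the infimum, a smaller nonnegative shift would
   lie in [E], or [M] itself would be expansive when [s = 0]. *)
have hB : ~ expansive (M + s%:M).
  move=> [L [pL pML]].
  have sL : (- 2 *: L)^T = - 2 *: L by rewrite linearZ /= posdef_sym.
  have [e e0 he] := posdef_perturb pML sL.
  have exp_sub d : 0 <= d <= e -> expansive (M + (s - d)%:M).
    move=> /he hd; exists L; split=> //.
    rewrite -shiftD lyap_shift; move: hd; congr posdefmx; congr (_ + _).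
    by rewrite scalerA; congr (_ *: _); ring.
  have [s_eq0|sn0] := eqVneq s 0.
    by apply: nM; have := @exp_sub 0; rewrite s_eq0 subr0 raddf0 addr0 lexx ltW //; apply.
  have s_gt0 : 0 < s by rewrite lt_def sn0.
  have d0 : 0 < Num.min e s by rewrite lt_min e0.
  have : s <= s - Num.min e s.
    apply: ge_inf; first by exists 0.
    split; first by rewrite subr_ge0 ge_min lexx orbT.
    by apply: exp_sub; rewrite ltW //= ge_min lexx.
  by rewrite lerBrDr gerDl leNgt d0.
(* In the singular case [z] and [- z] are eigenvalues of [M + s], so [z - s] and [- z - s] both have
   positive real part, although these real parts add up to [- 2 s <= 0]. *)
have [[Z [_ Z0 hZ]]|hsol] := lyap_dichotomy (M + s%:M).
  pose Mc := map_mx (real_complex K) (M + s%:M).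
  pose Zc := map_mx (real_complex K) Z.
  have hZc : lyap Mc Zc = 0.
    by rewrite /lyap /Mc /Zc (map_trmx (real_complex K)) -!map_mxM -map_mxD -/(lyap _ _) hZ map_mx0.
  have Zc0 : Zc != 0 by rewrite map_mx_eq0.
  have [z z1 z2] := lyap_ker_opp_eigenvalues hZc Zc0.
  have := hM _ (complex_eigenvalue_shift z1).
  have := hM _ (complex_eigenvalue_shift z2).
  by case: (z) => a b /=; lra.
(* In the solvable case [X] would certify [M + s]. It is positive definite because
   [lyap (M + s + e) X = 1 + 2 e X] is so for small [e], and [M + s + e] is expansive. *)
have [X sX hX] := hsol _ (@trmx1 _ n).
have sX2 : (2 *: X)^T = 2 *: X by rewrite linearZ /= sX.
have [e e0 he] := posdef_perturb (posdef1 n) sX2.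
apply: hB; exists X; rewrite hX; split; last exact: posdef1.
apply: (lyap_posdef (hA e e0)) => //.
rewrite lyap_shift hX mulrC -scalerA; apply: he; by rewrite lexx ltW.
Qed.

End ExpansiveSpectrum.

(** * The Riccati operator, its feedback form and its tangents *)

(** The quadratic form with blocks [A^T P + P A + Q], [P B + S] and [R], restricted to the graph
    [u = F x]. For fixed [F] it is linear in [(P, Q, S, R)] jointly, which is the source of all
    convexity below. *)
Definition feedback_riccati (K : pzRingType) n m (A : 'M[K]_n) (B : 'M[K]_(n, m))
    (Q : 'M[K]_n) (S : 'M[K]_(n, m)) (R : 'M[K]_m) (F : 'M[K]_(m, n))
    (P : 'M[K]_n) : 'M[K]_n :=
  lyap (A + B *m F) P + Q + (S *m F + (S *m F)^T) + F^T *m R *m F.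

Lemma feedback_riccati_lin (K : realType) n m (A : 'M[K]_n) (B : 'M[K]_(n, m))
    Q1 S1 R1 Q2 S2 R2 F P1 P2 (c d : K) :
  feedback_riccati A B (c *: Q1 + d *: Q2) (c *: S1 + d *: S2)
    (c *: R1 + d *: R2) F (c *: P1 + d *: P2) =
  c *: feedback_riccati A B Q1 S1 R1 F P1
    + d *: feedback_riccati A B Q2 S2 R2 F P2.
Proof.
rewrite /feedback_riccati lyapD !lyapZ !mulmxDl trmx_lin.
rewrite mulmxDr mulmxDl -!scalemxAl -!scalemxAr -!scalemxAl !trmx_lin.
by apply/matrixP=> i j; rewrite !mxlinE; ring.
Qed.

Section Riccati.
Context {K : realType} {n m : nat}.
Context (A : 'M[K]_n) (B : 'M[K]_(n, m)).
Context (Q : 'M[K]_n) (S : 'M[K]_(n, m)) (R : 'M[K]_m).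
Hypotheses (Q_sym : Q^T = Q) (R_neg : negdefmx R).

Let gain P : 'M[K]_(m, n) := - (invmx R *m (P *m B + S)^T).
Let ric := riccati A B Q S R.
Let cl := closed_loop A B S R.
Let fric := feedback_riccati A B Q S R.

Lemma negdef_sym : R^T = R.
Proof. by have := posdef_sym R_neg; rewrite linearN => /oppr_inj. Qed.

Lemma negdef_unit : R \in unitmx.
Proof.
have := posdef_unit R_neg.
by rewrite -scaleN1r unitmxZ // unitrN1.
Qed.

Lemma closed_loop_gain P : cl P = A + B *m gain P.
Proof. by rewrite /cl /closed_loop mulmxN mulmxA. Qed.

(** Completing the square in [F] around [gain P]; as [R] is negative definite, [gain P] is the
    maximizing feedback. *)
Lemma riccati_feedback F P :
  P^T = P -> ric P = fric F P - (F - gain P)^T *m R *m (F - gain P).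
Proof.
move=> sP; have sR := negdef_sym; have uR := negdef_unit.
set Y := P *m B + S.
have -> : fric F P =
    A^T *m P + P *m A + Q + (F^T *m Y^T + Y *m F) + F^T *m R *m F.
  rewrite /fric /feedback_riccati /lyap /Y !trmx_lin !trmx_mul sP.
  rewrite !mulmxDl !mulmxDr !mulmxA.
  by apply/matrixP=> i j; rewrite !mxlinE; ring.
rewrite /gain /ric /riccati -/Y opprK; clearbody Y.
rewrite trmx_add trmx_mul trmxK trmx_inv sR.
rewrite mulmxDl mulmxDr !mulmxDl mulmxKV // -!mulmxA (mulmxA R) mulmxV // mul1mx.
rewrite !mulmxA.
by apply/matrixP=> i j; rewrite !mxlinE; ring.
Qed.

Lemma riccati_gain P : P^T = P -> ric P = fric (gain P) P.
Proof. by move=> /(riccati_feedback (gain P)) ->; rewrite subrr mulmx0 subr0. Qed.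

Lemma feedback_riccati_le F P : P^T = P -> possemidefmx (ric P - fric F P).
Proof.
move=> sP; rewrite (riccati_feedback F sP) addrC addKr.
have -> : - ((F - gain P)^T *m R *m (F - gain P)) =
  (F - gain P)^T *m (- R) *m (F - gain P) by rewrite mulmxN mulNmx.
by apply: psd_congr; exact: posdef_psd.
Qed.

Lemma feedback_riccati_shift F P P' :
  fric F P' = fric F P + lyap (A + B *m F) (P' - P).
Proof.
rewrite /fric /feedback_riccati lyapD lyapN.
by apply/matrixP=> i j; rewrite !mxlinE; ring.
Qed.

(** With the feedback frozen at [gain P], [fric] is an affine minorant of [ric] that touches it at
    [P]. *)
Lemma riccati_tangent P P' : P^T = P -> P'^T = P' ->
  possemidefmx (ric P' - ric P - lyap (cl P) (P' - P)).
Proof.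
move=> sP sP'; have := feedback_riccati_le (gain P) sP'.
congr possemidefmx; rewrite (feedback_riccati_shift _ P) -riccati_gain //.
by rewrite -closed_loop_gain opprD addrA.
Qed.

Lemma riccati_sym P : P^T = P -> (ric P)^T = ric P.
Proof.
move=> sP; rewrite /ric /riccati !trmx_lin !trmx_mul !trmxK trmx_inv negdef_sym sP Q_sym.
by rewrite !trmx_lin !trmx_mul !trmxK sP mulmxA (addrC (P *m A)).
Qed.

(** The tangent inequality at [P] gives [lyap (cl P) (P - P') >= - ric P' >= 0], and [lyap_psd]
    removes the Lyapunov operator. *)
Lemma riccati_max P P' : P^T = P -> P'^T = P' ->
  ric P = 0 -> expansive (cl P) -> possemidefmx (- ric P') ->
  possemidefmx (P - P').
Proof.
move=> sP sP' P0 eP fP'; apply: (lyap_psd eP).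
  by rewrite !trmx_lin sP sP'.
have := psdD (riccati_tangent sP sP') fP'; congr possemidefmx.
rewrite P0 -(opprB P P') lyapN.
by apply/matrixP=> i j; rewrite !mxlinE; ring.
Qed.

Lemma riccati_max_strict P P' : P^T = P -> P'^T = P' ->
  ric P = 0 -> expansive (cl P) -> posdefmx (- ric P') -> posdefmx (P - P').
Proof.
move=> sP sP' P0 eP fP'; apply: (lyap_posdef eP).
  by rewrite !trmx_lin sP sP'.
have := posdef_psdD fP' (riccati_tangent sP sP'); congr posdefmx.
rewrite P0 -(opprB P P') lyapN.
by apply/matrixP=> i j; rewrite !mxlinE; ring.
Qed.

(** The difference [P - P'] is itself the certificate: its Lyapunov image dominates
    [ric P - ric P'], which is positive definite. *)
Lemma closed_loop_expansive P P' : P^T = P -> P'^T = P' ->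
  possemidefmx (ric P) -> posdefmx (- ric P') -> possemidefmx (P - P') ->
  expansive (cl P).
Proof.
move=> sP sP' fP fP' le.
have sPP' : (P - P')^T = P - P' by rewrite !trmx_lin sP sP'.
have pl : posdefmx (lyap (cl P) (P - P')).
  have := posdef_psdD (posdef_psdD fP' fP) (riccati_tangent sP sP').
  congr posdefmx; rewrite -(opprB P P') lyapN.
  by apply/matrixP=> i j; rewrite !mxlinE; ring.
by exists (P - P'); split=> //; apply: psd_posdef => // x; exact: (lyap_ker sPP' pl).
Qed.

(** Moving from [P] to [P - e X] with [lyap (cl P) X = 1] changes [ric] by [- e] to first order; the
    exact value is [- e (1 + e W)], negative definite for small [e]. *)
Lemma antistab_strictly_feasible P : P^T = P ->
  ric P = 0 -> expansive (cl P) -> exists2 P0, P0^T = P0 & posdefmx (- ric P0).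
Proof.
move=> sP P0 eP; have [X sX hX] := lyap_solve eP (@trmx1 _ n).
pose W := X *m B *m invmx R *m (X *m B)^T.
have sW : W^T = W.
  rewrite /W; move: (X *m B) => N.
  by rewrite !trmx_mul trmxK trmx_inv negdef_sym mulmxA.
have [e e0 he] := posdef_perturb (posdef1 n) sW.
have sPX : (P - e *: X)^T = P - e *: X by rewrite !trmx_lin sP sX.
exists (P - e *: X) => //.
rewrite (riccati_feedback (gain P) sPX) (feedback_riccati_shift _ P).
rewrite -riccati_gain // -closed_loop_gain P0.
rewrite [P - _ - P]addrAC subrr !add0r lyapN lyapZ hX.
have -> : gain P - gain (P - e *: X) = - (e *: (invmx R *m (X *m B)^T)).
  rewrite /gain mulmxDl mulNmx -scalemxAl !trmx_lin !mulmxDr mulmxN -scalemxAr.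
  by apply/matrixP=> i j; rewrite !mxlinE; ring.
have -> : - (- (e *: 1%:M) - (- (e *: (invmx R *m (X *m B)^T)))^T *m R *m
   - (e *: (invmx R *m (X *m B)^T))) = e *: (1%:M + e *: W).
  rewrite /W; move: (X *m B) => N.
  rewrite !trmx_lin trmx_mul trmxK trmx_inv negdef_sym !mulNmx mulmxN !opprK.
  rewrite -scalemxAr -!scalemxAl mulmxA mulmxKV ?negdef_unit //.
  by rewrite opprD !opprK scalerDr.
by apply: posdefZ => //; apply: he; rewrite lexx ltW.
Qed.

End Riccati.

(** * Entry bounds and closed conditions for semidefinite matrices *)

Section PsdEntries.
Context {K : realType}.

Lemma dot_delta n (M : 'M[K]_n) i j :
  dot (delta_mx i 0) (M *m delta_mx j 0) = M i j.
Proof. by rewrite /dot trmx_delta -rowE -colE !mxE. Qed.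

Lemma psd_diag n (M : 'M[K]_n) i : possemidefmx M -> 0 <= M i i.
Proof. by move=> /possemidefmxP[_ /(_ (delta_mx i 0))]; rewrite dot_delta. Qed.

Lemma psd_trace n (M : 'M[K]_n) : possemidefmx M -> 0 <= \tr M.
Proof. by move=> pM; apply: sumr_ge0 => i _; exact: psd_diag. Qed.

(** Testing at [e_i + e_j] and [e_i - e_j] bounds [|M i j|] by the mean of two diagonal entries.
    This turns a trace bound into compactness. *)
Lemma psd_entry n (M : 'M[K]_n) i j : possemidefmx M -> `|M i j| <= \tr M.
Proof.
move=> pM; have d k : M k k <= \tr M.
  by rewrite /mxtrace (bigD1 k) //= lerDl sumr_ge0 // => l _; exact: psd_diag.
have [sM /[dup] hp hm] := (possemidefmxP _).1 pM.
have sMij : M j i = M i j by rewrite -[in LHS]sM mxE.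
have := hp (delta_mx i 0 + delta_mx j 0).
have := hm (delta_mx i 0 - delta_mx j 0).
rewrite !mulmxDr mulmxN !dot_lin !dot_delta sMij.
have := d i; have := d j; move: (\tr M) => t d1 d2 h1 h2.
by rewrite ler_norml; apply/andP; split; lra.
Qed.

Lemma psd_trace_eq0 n (M : 'M[K]_n) : possemidefmx M -> \tr M <= 0 -> M = 0.
Proof.
move=> pM t0; apply/matrixP=> i j; rewrite mxE; apply/eqP; rewrite -normr_le0.
exact: le_trans (psd_entry i j pM) t0.
Qed.

End PsdEntries.

Section ClosedConditions.
Context {K : realType} {T : topologicalType}.

Lemma closed_eqmx a b (f g : T -> 'M[K]_(a, b)) :
  mx_continuous f -> mx_continuous g -> closed [set u | f u = g u].
Proof.
move=> cf cg.
have -> : [set u | f u = g u] = \bigcap_(k : 'I_a * 'I_b)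
    (fun u => f u k.1 k.2 - g u k.1 k.2) @^-1` [set 0].
  apply/seteqP; split=> [u /= fg k _ /=|u h /=]; first by rewrite fg subrr.
  by apply/matrixP=> i j; apply/eqP; rewrite -subr_eq0; apply/eqP; exact: (h (i, j)).
apply: closed_bigI => k _; apply: preimage_closed; last exact: closed_eq.
by move=> u _; exact: (continuousB (cf _ _ u) (cg _ _ u)).
Qed.

Lemma closed_psd n (f : T -> 'M[K]_n) :
  mx_continuous f -> closed [set u | possemidefmx (f u)].
Proof.
move=> cf.
have -> : [set u | possemidefmx (f u)] = [set u | (f u)^T = f u] `&`
    \bigcap_(x : 'cV[K]_n) (fun u => dot x (f u *m x)) @^-1` [set y | 0 <= y].
  apply/seteqP; split=> [u /possemidefmxP[sf hf]|u [sf hf]].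
    by split=> // x _; exact: hf.
  by apply/possemidefmxP; split=> // x; exact: hf.
apply: closedI; first by apply: closed_eqmx => //; exact: mx_continuous_tr.
apply: closed_bigI => x _; apply: preimage_closed; last exact: closed_ge.
move=> u _; apply: continuous_dot; first exact: mx_continuous_cst.
by apply: mx_continuousM => //; exact: mx_continuous_cst.
Qed.

End ClosedConditions.

Lemma mx_continuous_vec_mx (K : realType) a b :
  mx_continuous (fun u : 'rV[K]_(a * b) => vec_mx u : 'M[K]_(a, b)).
Proof.
move=> i j; under [X in continuous X]eq_fun do rewrite mxE.
by move=> u; exact: coord_continuous.
Qed.

(** * Existence of a solution with expansive closed loop *)

Section RiccatiExistence.
Context {K : realType} {n m : nat}.
Context (A : 'M[K]_n) (B : 'M[K]_(n, m)).
Context (Q : 'M[K]_n) (S : 'M[K]_(n, m)) (R : 'M[K]_m).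
Hypotheses (Q_sym : Q^T = Q) (R_neg : negdefmx R).

Let ric := riccati A B Q S R.
Let cl := closed_loop A B S R.

(** The feasible set of the trace minimization: [ric P >= 0], and [P] lies above every symmetric
    [P'] with [ric P' <= 0]. *)
Let dominating : set 'M[K]_n := [set P | [/\ P^T = P, possemidefmx (ric P) &
  forall P', P'^T = P' -> possemidefmx (- ric P') -> possemidefmx (P - P')]].

(** Every feasible [P'] satisfies [fric F P' <= ric P' <= 0 = fric F P], so [P - P'] has a
    semidefinite Lyapunov image. Used both for the starting point and for the Newton step. *)
Lemma feedback_solution_dominating F P :
  P^T = P -> feedback_riccati A B Q S R F P = 0 -> expansive (A + B *m F) ->
  dominating P.
Proof.
move=> sP FP eF; split=> // [|P' sP' fP'].
  by have := feedback_riccati_le A B Q S R_neg F sP; rewrite FP subr0.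
apply: (lyap_psd eF); first by rewrite !trmx_lin sP sP'.
have := psdD (feedback_riccati_le A B Q S R_neg F sP') fP'; congr possemidefmx.
have := feedback_riccati_shift A B Q S R F P P'; rewrite FP add0r => ->.
rewrite -(opprB P P') lyapN.
by apply/matrixP=> i j; rewrite !mxlinE; ring.
Qed.

Lemma dominating_closed :
  closed [set u : 'rV[K]_(n * n) | dominating (vec_mx u)].
Proof.
pose V (u : 'rV[K]_(n * n)) : 'M[K]_n := vec_mx u.
have cV : mx_continuous V by exact: mx_continuous_vec_mx.
have cc a b (M : 'M[K]_(a, b)) : mx_continuous (fun _ : 'rV[K]_(n * n) => M).
  exact: mx_continuous_cst.
have -> : [set u : 'rV[K]_(n * n) | dominating (vec_mx u)] =
    [set u | (V u)^T = V u] `&` [set u | possemidefmx (ric (V u))] `&`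
    \bigcap_(P' in [set P' | P'^T = P' /\ possemidefmx (- ric P')])
      [set u | possemidefmx (V u - P')].
  apply/seteqP; split=> [u [h1 h2 h3]|u [[h1 h2] h3]].
    by split=> // P' [? ?]; exact: h3.
  by split=> // P' ? ?; apply: h3.
have cVB : mx_continuous (fun u => V u *m B + S).
  by apply: mx_continuousD => //; exact: mx_continuousM.
apply: closedI; [apply: closedI|apply: closed_bigI => P' _].
- by apply: closed_eqmx => //; exact: mx_continuous_tr.
- apply: closed_psd; rewrite /ric /riccati.
  apply: mx_continuousD; last first.
    apply: mx_continuousN; apply: mx_continuousM; last exact: mx_continuous_tr.
    exact: mx_continuousM.
  apply: mx_continuousD => //.
  by apply: mx_continuousD; exact: mx_continuousM.
- by apply: closed_psd; exact: mx_continuousD.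
Qed.

(* A trace-minimal P among those dominating every feasible matrix is fixed by
   Newton's step, which would otherwise decrease the trace. *)
Lemma riccati_expansive_solution F P0 :
  expansive (A + B *m F) -> P0^T = P0 -> posdefmx (- ric P0) ->
  exists P, [/\ P^T = P, ric P = 0 & expansive (cl P)].
Proof.
move=> eF sP0 fP0.
have [Pi sPi hPi] : exists2 Pi, Pi^T = Pi & feedback_riccati A B Q S R F Pi = 0.
  pose E := Q + (S *m F + (S *m F)^T) + F^T *m R *m F.
  have sE : (- E)^T = - E.
    rewrite /E !trmx_lin trmxK (trmx_mul (F^T *m R)) (trmx_mul _ R) trmxK.
    by rewrite (negdef_sym R_neg) Q_sym mulmxA (addrC _ (S *m F)).
  have [X sX hX] := lyap_solve eF sE; exists X => //.
  rewrite /feedback_riccati hX /E.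
  by apply/matrixP=> i j; rewrite !mxlinE; ring.
have dPi := feedback_solution_dominating sPi hPi eF.
pose G := [set u : 'rV[K]_(n * n) |
  dominating (vec_mx u) /\ \tr (vec_mx u : 'M[K]_n) <= \tr Pi].
have ctr : continuous (fun u : 'rV[K]_(n * n) => \tr (vec_mx u : 'M[K]_n)).
  by apply: continuous_sum_ord => i; exact: mx_continuous_vec_mx.
have cG : compact G.
  (* A dominating matrix minus [P0] is semidefinite with trace at most [tr Pi - tr P0], which bounds
     its entries; the double sum accounts for the entries of [P0]. *)
  pose c := \tr Pi - \tr P0 + \sum_i \sum_j `|P0 i j|.
  apply: (@compact_box _ _ c) => [u [[_ _ dom] tru] k|].
    have := dom _ sP0 (posdef_psd fP0).
    case/mxvec_indexP: k => i j.
    have -> : u 0 (mxvec_index i j) = vec_mx u i j by rewrite mxE.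
    move=> /(psd_entry i j); rewrite !mxlinE linearB /= => hij.
    have hP0 : `|P0 i j| <= \sum_i \sum_j `|P0 i j|.
      rewrite (bigD1 i) //= (bigD1 j) //= -addrA lerDl addr_ge0 ?sumr_ge0 // => k _.
      by rewrite sumr_ge0.
    rewrite -(subrK (P0 i j) (vec_mx u i j)) (le_trans (ler_normD _ _)) //.
    by rewrite /c lerD // (le_trans hij) // lerD2r.
  apply: closedI; first exact: dominating_closed.
  apply: (@preimage_closed _ _ _ [set y | y <= \tr Pi]); last exact: closed_le.
  by move=> u _; exact: ctr.
have G0 : G !=set0 by exists (mxvec Pi); rewrite /G /= mxvecK.
have [u /set_mem[du tru] umin] := EVT_min_rV G0 cG (continuous_subspaceT ctr).
set P : 'M[K]_n := vec_mx u in du tru umin.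
have [sP fP dP] := du.
have eP : expansive (cl P).
  by apply: (closed_loop_expansive R_neg sP sP0 fP fP0); apply: dP => //; exact: posdef_psd.
have sfP : (- ric P)^T = - ric P by rewrite trmx_opp (riccati_sym _ _ _ Q_sym R_neg sP).
(* [Y] is the Newton increment at [P]. It is negative semidefinite as [ric P >= 0], and [P + Y]
   solves the feedback equation for the gain of [P], so it is again dominating; minimality of the
   trace then forces [Y = 0]. *)
have [Y sY hY] := lyap_solve eP sfP.
have pY : possemidefmx (- Y).
  apply: (lyap_psd eP); first by rewrite trmx_opp sY.
  by rewrite lyapN hY opprK.
have sPY : (P + Y)^T = P + Y by rewrite trmx_add sP sY.
have dPY : dominating (P + Y).
  pose N := - (invmx R *m (P *m B + S)^T).
  have eN : cl P = A + B *m N by exact: closed_loop_gain.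
  apply: (@feedback_solution_dominating N) => //; last by rewrite -eN.
  rewrite (feedback_riccati_shift _ _ _ _ _ _ P) -eN (addrC P) addrK hY.
  by rewrite -riccati_gain // subrr.
have trY := psd_trace pY.
have trPY : \tr (P + Y) <= \tr P.
  by rewrite mxtraceD gerDl; move: trY; rewrite linearN /= oppr_ge0.
have GPY : G (mxvec (P + Y)).
  by rewrite /G /= mxvecK; split=> //; exact: le_trans trPY tru.
have := umin _ (mem_set GPY).
rewrite mxvecK -/P mxtraceD lerDl => trY'.
have Y0 : - Y = 0 by apply: psd_trace_eq0; rewrite // linearN /= oppr_le0.
exists P; split=> //.
by apply: oppr_inj; rewrite -hY -[Y]opprK Y0 !oppr0 /lyap mulmx0 mul0mx addr0.
Qed.

End RiccatiExistence.

(** * Controllability and expansive feedbacks *)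

(* Bass's algorithm: with Z solving (c - A) Z + Z (c - A)^T = B B^T, the
   feedback B^T Z^-1 / 2 satisfies (A + B F) Z + Z (A + B F)^T = 2 c Z. *)
Lemma observable_expansive_feedback (K : realType) n m
    (A : 'M[K]_n) (B : 'M[K]_(n, m)) :
  (forall v : 'rV[K]_n, (forall k : nat, v *m A ^+ k *m B = 0) -> v = 0) ->
  exists F, expansive (A + B *m F).
Proof.
move=> obs; have [c c0 ec] := expansive_shift_large (- A^T).
have sBB : (B *m B^T)^T = B *m B^T by rewrite trmx_mul trmxK.
have [Z sZ hZ] := lyap_solve ec sBB.
have hZ' : B *m B^T + A *m Z + Z *m A^T = (2 * c) *: Z.
  rewrite -hZ lyap_shift /lyap trmx_opp trmxK mulNmx mulmxN.
  by apply/matrixP=> i j; rewrite !mxlinE; ring.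
have pZ : posdefmx Z.
  apply: psd_posdef => [|x Zx].
    apply: (lyap_psd ec sZ); rewrite hZ.
    by have := psd_congr B^T (posdef_psd (posdef1 m)); rewrite trmxK mulmx1.
  (* The kernel of [Z] is stable under [A^T] and annihilated by [B^T], so the hypothesis on
     [A ^+ k *m B] makes it trivial. *)
  have step (y : 'cV_n) : Z *m y = 0 -> B^T *m y = 0 /\ Z *m (A^T *m y) = 0.
    move=> Zy; have := congr1 (mulmx^~ y) hZ'.
    rewrite -scalemxAl Zy scaler0 !mulmxDl -!mulmxA Zy mulmx0 addr0 => h.
    have By : B^T *m y = 0.
      apply: dot_eq0; rewrite -dot_adj.
      by have := congr1 (dot y) h; rewrite dotDr dot0r (dot_adj Z) sZ Zy dot0l addr0.
    by move: h; rewrite By mulmx0 add0r.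
  have iter k : Z *m ((A ^+ k)^T *m x) = 0.
    elim: k => [|k IHk]; first by rewrite expr0 trmx1 mul1mx.
    by rewrite exprSr -mulmxE trmx_mul -mulmxA; have [] := step _ IHk.
  apply: trmx_inj; rewrite trmx0; apply: obs => k; apply: trmx_inj.
  rewrite !trmx_mul trmxK trmx0; by have [] := step _ (iter k).
have uZ := posdef_unit pZ.
have pN := posdef_inv pZ; set N := invmx Z in pN *.
have sN := posdef_sym pN.
exists (2^-1 *: (B^T *m N)), N; split=> //.
(* Congruence by [N = Z^-1] turns the identity for [Z] into a Lyapunov identity with certificate
   [N]. *)
have -> : lyap (A + B *m (2^-1 *: (B^T *m N))) N = (2 * c) *: N.
  have := congr1 (fun X : 'M[K]_n => N *m X *m N) hZ'.
  rewrite -scalemxAr -scalemxAl !mulmxDr !mulmxDl mulVmx // mul1mx => <-.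
  have [NZ ZN] : N *m Z = 1%:M /\ Z *m N = 1%:M by rewrite mulVmx ?mulmxV.
  rewrite /lyap trmx_add trmx_mul trmx_scale trmx_mul trmxK sN.
  rewrite mulmxDl mulmxDr -!scalemxAr -!scalemxAl !mulmxA NZ mul1mx -(mulmxA _ Z N) ZN mulmx1.
  by apply/matrixP=> i j; rewrite !mxlinE; field.
by apply: posdefZ => //; rewrite mulr_gt0.
Qed.

Lemma controllable_observable (K : realType) n m (A : 'M[K]_n) (B : 'M[K]_(n, m)) :
  controllable A B ->
  forall v : 'rV[K]_n, (forall k : nat, v *m A ^+ k *m B = 0) -> v = 0.
Proof.
move=> ctrl v hv.
have rf : row_free (\mxrow_(i < n) (A ^+ i *m B)) by rewrite /row_free ctrl.
apply/eqP; rewrite -(mulmx_free_eq0 _ rf); apply/eqP.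
rewrite mul_mxrow; apply/mxrowP => i.
by rewrite mxrowK submxrow0 mulmxA hv.
Qed.

(** The vectors annihilating all [A^k B] are unchanged by [(A, B) -> (- A, - B)], since each product
    only changes sign. The second feedback serves [P_minus]. *)
Lemma controllable_feedbacks (K : realType) n m
    (A : 'M[K]_n) (B : 'M[K]_(n, m)) : controllable A B ->
  (exists F, expansive (A + B *m F)) /\ (exists F, expansive (- A + - B *m F)).
Proof.
move=> /controllable_observable obs; split.
  exact: observable_expansive_feedback.
apply: observable_expansive_feedback => v hv; apply: obs => k.
have := hv k; rewrite exprNn -signr_odd; case: (odd k).
  by rewrite expr1 mulN1r !mulmxN mulNmx opprK.
by rewrite expr0 mul1r mulmxN => /eqP; rewrite oppr_eq0 => /eqP.
Qed.

(** * Cholesky factors, log-determinants and traces of products *)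

Section Cholesky.
Context {K : realType}.

Lemma schur_posdef n (a : K) (b : 'cV[K]_n) (C : 'M[K]_n) :
  posdefmx (block_mx a%:M b^T b C : 'M[K]_(1 + n)) ->
  0 < a /\ posdefmx (C - a^-1 *: (b *m b^T)).
Proof.
move=> pM; have [_ hM] := (posdefmxP _).1 pM.
have a0 : 0 < a.
  have e0 : (delta_mx 0 0 : 'cV[K]_(1 + n)) != 0.
    apply/negP => /eqP/matrixP/(_ 0 0); rewrite !mxE eqxx => /eqP.
    by rewrite oner_eq0.
  have := hM _ e0; rewrite dot_delta.
  have -> : (0 : 'I_(1 + n)) = lshift n 0 by apply/val_inj.
  by rewrite block_mxEul mxE.
split=> //.
pose N : 'M[K]_(1 + n, n) := col_mx (- (a^-1 *: b^T)) 1%:M.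
have -> : C - a^-1 *: (b *m b^T) = N^T *m block_mx a%:M b^T b C *m N.
  rewrite /N tr_col_mx mul_row_block mul_row_col.
  rewrite trmx1 !mul1mx mulmx1 !trmx_lin trmxK.
  rewrite !mulNmx !mulmxN -!scalemxAl -!scalemxAr mul_mx_scalar scalerA.
  by rewrite mulVf ?gt_eqF // scale1r addNr mul0mx scaler0 oppr0 add0r addrC.
apply: posdef_congr => // x.
rewrite /N mul_col_mx mul1mx => /eqP; rewrite col_mx_eq0 => /andP[_ /eqP].
exact.
Qed.

(** Induction through the Schur complement of the top left entry [a]: the first column of the factor
    is [(sqrt a, b / sqrt a)], the rest factors the complement. *)
Lemma cholesky n (M : 'M[K]_n) : posdefmx M ->
  exists G : 'M[K]_n,
    [/\ M = G *m G^T, is_trig_mx G & forall i, G i i != 0].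
Proof.
elim: n M => [|n IHn] M pM.
  by exists 0; split; [apply/matrixP=> -[]|apply/is_trig_mxP=> -[]|case].
move: M pM; rewrite -[n.+1]/(1 + n)%N => M pM.
pose a := ulsubmx M 0 0; pose b := dlsubmx M; pose C := drsubmx M.
have sM := posdef_sym pM.
have eM : M = block_mx a%:M b^T b C.
  rewrite -[LHS]submxK; congr block_mx; first exact: mx11_scalar.
  by rewrite /b trmx_dlsub sM.
have [a0 pS] : 0 < a /\ posdefmx (C - a^-1 *: (b *m b^T)).
  by apply: schur_posdef; rewrite -eM.
have [H [eH tH dH]] := IHn _ pS.
set s := Num.sqrt a; have s0 : 0 < s by rewrite sqrtr_gt0.
have s2 : s * s = a by rewrite -expr2 sqr_sqrtr // ltW.
exists (block_mx s%:M 0 (s^-1 *: b) H : 'M[K]_(1 + n)); split.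
- rewrite tr_block_mx mulmx_block tr_scalar_mx !trmx0 !mulmx0 !mul0mx !addr0.
  rewrite -scalar_mxM s2 -eH !trmx_lin -!scalemxAl -!scalemxAr mul_scalar_mx.
  rewrite mul_mx_scalar !scalerA mulVf ?mulfV ?gt_eqF // !scale1r -invfM s2.
  by rewrite addrC subrK.
- by rewrite is_trig_block_mx // eqxx tH scalar_mx_is_trig.
- move=> i; case: (splitP i) => j ij.
    have -> : i = lshift n j by apply/val_inj.
    by rewrite block_mxEul (ord1 j) mxE gt_eqF.
  have -> : i = rshift 1 j by apply/val_inj.
  by rewrite block_mxEdr.
Qed.

Lemma cholesky_unit n (M : 'M[K]_n) : posdefmx M ->
  exists2 G : 'M[K]_n, M = G *m G^T & G \in unitmx.
Proof.
move=> /cholesky[G [eM tG dG]]; exists G => //.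
by rewrite unitmxE unitfE det_trig // prodf_seq_neq0; apply/allP=> i _ /=.
Qed.

Lemma posdef_det_gt0 n (M : 'M[K]_n) : posdefmx M -> 0 < \det M.
Proof.
move=> /cholesky_unit[G -> uG]; rewrite det_mulmx det_tr -expr2.
by rewrite exprn_even_gt0 //=; move: uG; rewrite unitmxE unitfE.
Qed.

(** Hadamard's inequality, [det M = prod (G i i)^2 <= prod (M i i)], followed by [x <= exp (x - 1)]
    on each diagonal entry. *)
Lemma ln_det_le_trace n (M : 'M[K]_n) : posdefmx M -> ln (\det M) <= \tr M - n%:R.
Proof.
move=> pM; have d0 := posdef_det_gt0 pM.
rewrite -[leRHS]expRK ler_ln ?posrE ?expR_gt0 //.
have [G [eM tG _]] := cholesky pM.
have -> : \det M = \prod_i (G i i ^+ 2).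
  by rewrite eM det_mulmx det_tr det_trig // -big_split.
have -> : \tr M - n%:R = \sum_i (M i i - 1).
  by rewrite sumrB sumr_const card_ord.
rewrite expR_sum; apply: ler_prod => i _; rewrite sqr_ge0 /=.
apply: (@le_trans _ _ (M i i)).
  rewrite eM mxE (bigD1 i) //= mxE -expr2 lerDl.
  by apply: sumr_ge0 => k _; rewrite mxE -expr2 sqr_ge0.
by have := expR_ge1Dx (M i i - 1); rewrite addrC subrK.
Qed.

(** The previous bound applied to [G^-1 M G^-T], where [P = G G^T]. *)
Lemma ln_det_tangent n (P M : 'M[K]_n) : posdefmx P -> posdefmx M ->
  ln (\det M) <= ln (\det P) + \tr (invmx P *m (M - P)).
Proof.
move=> pP pM; have [G eP uG] := cholesky_unit pP.
set H := invmx G; have uH : H \in unitmx by rewrite unitmx_inv.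
have pN : posdefmx (H *m M *m H^T).
  rewrite -{1}[H]trmxK; apply: posdef_congr => // x.
  by move/(congr1 (mulmx (invmx H^T))); rewrite mulKmx ?unitmx_tr // mulmx0.
have dM := posdef_det_gt0 pM; have dP := posdef_det_gt0 pP.
have eiP : invmx P = H^T *m H.
  rewrite -[RHS](mulmxK (posdef_unit pP)) {2}eP mulmxA -(mulmxA H^T) mulVmx //.
  by rewrite mulmx1 -trmx_mul mulmxV // trmx1 mul1mx.
have := ln_det_le_trace pN.
have -> : \det (H *m M *m H^T) = \det M / \det P.
  rewrite !det_mulmx -det_inv eiP det_mulmx det_tr.
  by rewrite mulrC mulrA [RHS]mulrC.
rewrite ln_div ?posrE // lerBlDl => /le_trans; apply; rewrite lerD2l.
rewrite -mxtrace_mulC mulmxA -eiP mulmxBr mulVmx ?posdef_unit // linearB /=.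
by rewrite mxtrace1.
Qed.

Lemma trace_posdef_psd n (M X : 'M[K]_n) :
  posdefmx M -> possemidefmx X -> 0 <= \tr (M *m X).
Proof.
move=> /cholesky_unit[G -> uG] pX.
rewrite -mulmxA mxtrace_mulC; exact/psd_trace/psd_congr.
Qed.

(** Adding [d] times the identity makes the first factor positive definite, at a cost [d tr X] below
    the arbitrary [e]. *)
Lemma trace_psd_psd n (M X : 'M[K]_n) :
  possemidefmx M -> possemidefmx X -> 0 <= \tr (M *m X).
Proof.
move=> pM pX; apply/ler_addgt0Pr => e e0.
have tX := psd_trace pX; have t1 : 0 < \tr X + 1 by rewrite ltr_wpDl.
have d0 : 0 < e / (\tr X + 1) by rewrite divr_gt0.
have := trace_posdef_psd (posdef_psdD (posdefZ d0 (posdef1 n)) pM) pX.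
rewrite mulmxDl linearD /= -scalemxAl mul1mx linearZ /= addrC => /le_trans; apply.
rewrite lerD2l mulrAC ler_pdivrMr // ler_pM2l //.
by rewrite lerDl.
Qed.

(** Concavity and monotonicity at once: averaging the tangent bounds at [M] leaves the trace of
    [M^-1] times the average minus [M], which is nonpositive. *)
Lemma ln_det_concave n (M1 M2 M : 'M[K]_n) t : 0 <= t <= 1 ->
  posdefmx M1 -> posdefmx M2 -> posdefmx M ->
  possemidefmx (M - (t *: M1 + (1 - t) *: M2)) ->
  t * ln (\det M1) + (1 - t) * ln (\det M2) <= ln (\det M).
Proof.
move=> /andP[t0 t1] p1 p2 pM h.
have h1 := ln_det_tangent pM p1; have h2 := ln_det_tangent pM p2.
have := trace_psd_psd (posdef_psd (posdef_inv pM)) h.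
have -> : M - (t *: M1 + (1 - t) *: M2) =
    - (t *: (M1 - M) + (1 - t) *: (M2 - M)).
  by apply/matrixP=> i j; rewrite !mxlinE; ring.
rewrite mulmxN mulmxDr -!scalemxAr linearN linearD /= !linearZ /=.
have t1' : 0 <= 1 - t by rewrite subr_ge0.
have := ler_wpM2l t0 h1; have := ler_wpM2l t1' h2.
by clear; lra.
Qed.

End Cholesky.

(** * Convex combinations of matrices and of affine data *)

Section ConvexCombinations.
Context {K : realType}.
Implicit Type t : {i01 K}.

Lemma psd_conv n t (M N : 'M[K]_n) : possemidefmx M -> possemidefmx N ->
  possemidefmx (t%:num *: M + (1 - t%:num) *: N).
Proof.
by move=> pM pN; apply: psdD; apply: psdZ => //; rewrite subr_ge0.
Qed.

Lemma posdef_conv n t (M N : 'M[K]_n) : posdefmx M -> posdefmx N ->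
  posdefmx (t%:num *: M + (1 - t%:num) *: N).
Proof.
move=> pM pN; have [t0|t0] := eqVneq t%:num 0.
  by rewrite t0 scale0r add0r subr0 scale1r.
apply: posdef_psdD; first by apply: posdefZ => //; rewrite lt_def t0 /=.
by apply: psdZ; [rewrite subr_ge0|exact: posdef_psd].
Qed.

Lemma affine_mx_conv p a b (H : 'I_p.+1 -> 'M[K]_(a, b)) t
    (x y : convex_lmodType 'rV[K]_p) :
  affine_mx H (conv t x y) =
  t%:num *: affine_mx H x + (1 - t%:num) *: affine_mx H y.
Proof.
rewrite /affine_mx.
have -> : \sum_(i < p) (conv t x y : 'rV_p) 0 i *: H (lift ord0 i) =
    t%:num *: \sum_(i < p) (x : 'rV_p) 0 i *: H (lift ord0 i) +
    (1 - t%:num) *: \sum_(i < p) (y : 'rV_p) 0 i *: H (lift ord0 i).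
  rewrite !scaler_sumr -big_split /=; apply: eq_bigr => i _.
  by rewrite /conv /= /isConvexSpace.conv /= !mxE !scalerA -scalerDl.
move: (\sum_(i < p) (x : 'rV_p) 0 i *: _) (\sum_(i < p) (y : 'rV_p) 0 i *: _).
by move=> X Y; apply/matrixP=> i j; rewrite !mxlinE; ring.
Qed.

Lemma affine_mx_sym p n (H : 'I_p.+1 -> 'M[K]_n) x :
  (forall i, H i \is symmetricmx) -> (affine_mx H x)^T = affine_mx H x.
Proof.
move=> sH; rewrite /affine_mx trmx_add (symmxP _).1 // linear_sum /=.
by congr (_ + _); apply: eq_bigr => i _; rewrite trmx_scale (symmxP _).1.
Qed.

End ConvexCombinations.

(** * Certified solutions, sign symmetry and combination of data *)

Section AntistabilizingSolutions.
Context {K : realType} {n m : nat}.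
Implicit Types (A Q P : 'M[K]_n) (B S : 'M[K]_(n, m)) (R : 'M[K]_m).

Definition expansive_solution A B Q S R P :=
  [/\ P^T = P, riccati A B Q S R P = 0 & expansive (closed_loop A B S R P)].

Lemma antistabilizingP A B Q S R P : negdefmx R ->
  antistabilizing A B Q S R P <-> expansive_solution A B Q S R P.
Proof.
move=> nR; split=> [[_ /symmxP sP eP hP]|[sP eP hP]].
  by split=> //; exact: eigenvalue_expansive.
split=> //; [exact: negdef_unit|exact/symmxP|move=> z].
exact: expansive_eigenvalue.
Qed.

Lemma riccati_opp A B Q S R P :
  riccati (- A) (- B) Q S R (- P) = riccati A B Q S R P.
Proof. by rewrite /riccati !mulNmx !mulmxN trmx_opp !mulNmx !opprK. Qed.

Lemma closed_loop_opp A B S R P :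
  closed_loop (- A) (- B) S R (- P) = - closed_loop A B S R P.
Proof. by rewrite /closed_loop !mulNmx !mulmxN !opprK opprB addrC. Qed.

Lemma complex_eigenvalue_opp A z :
  complex_eigenvalue (- A) z -> complex_eigenvalue A (- z).
Proof.
move=> /eigenvalueP[v vA v0]; apply/eigenvalueP; exists v => //.
by rewrite -[LHS]opprK -mulmxN -map_mxN vA scaleNr.
Qed.

Lemma stabilizing_opp A B Q S R P :
  stabilizing A B Q S R P <-> antistabilizing (- A) (- B) Q S R (- P).
Proof.
have ReN (z : K[i]) : complex.Re (- z) = - complex.Re z by case: z.
rewrite /stabilizing /antistabilizing riccati_opp closed_loop_opp.
split=> -[uR /symmxP sP eP hP]; split; [exact: uR| |exact: eP| |
                                         exact: uR| |exact: eP|].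
- by apply/symmxP; rewrite trmx_opp sP.
- move=> z /complex_eigenvalue_opp/hP; rewrite ReN oppr_lt0; exact.
- by apply/symmxP; apply: oppr_inj; rewrite -trmx_opp sP.
- move=> z hz; rewrite -oppr_gt0 -ReN; apply: hP.
  by apply: complex_eigenvalue_opp; rewrite !opprK.
Qed.

Section Combination.
Variables (A : 'M[K]_n) (B : 'M[K]_(n, m)) (t : {i01 K}).
Variables (Q1 Q2 : 'M[K]_n) (S1 S2 : 'M[K]_(n, m)) (R1 R2 : 'M[K]_m).
Hypotheses (R1_neg : negdefmx R1) (R2_neg : negdefmx R2).

Let Q := t%:num *: Q1 + (1 - t%:num) *: Q2.
Let S := t%:num *: S1 + (1 - t%:num) *: S2.
Let R := t%:num *: R1 + (1 - t%:num) *: R2.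

Lemma negdef_conv : negdefmx R.
Proof.
by rewrite /negdefmx /R opprD -!scalerN; exact: posdef_conv.
Qed.

(** Freeze the feedback at the gain of the combined data: there [ric] equals the linear [fric],
    while at each endpoint [ric] dominates [fric]. *)
Lemma riccati_convex P1 P2 : P1^T = P1 -> P2^T = P2 ->
  possemidefmx (t%:num *: riccati A B Q1 S1 R1 P1
    + (1 - t%:num) *: riccati A B Q2 S2 R2 P2
    - riccati A B Q S R (t%:num *: P1 + (1 - t%:num) *: P2)).
Proof.
move=> s1 s2; set P := t%:num *: P1 + _.
have sP : P^T = P by rewrite !trmx_lin s1 s2.
rewrite (riccati_gain _ _ _ _ negdef_conv sP) feedback_riccati_lin.
set F := - (_ *m _^T).
have := psd_conv t (feedback_riccati_le A B Q1 S1 R1_neg F s1)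
  (feedback_riccati_le A B Q2 S2 R2_neg F s2).
by congr possemidefmx; apply/matrixP=> i j; rewrite !mxlinE; ring.
Qed.

Lemma strictly_feasible_conv P1 P2 : P1^T = P1 -> P2^T = P2 ->
  posdefmx (- riccati A B Q1 S1 R1 P1) -> posdefmx (- riccati A B Q2 S2 R2 P2) ->
  posdefmx (- riccati A B Q S R (t%:num *: P1 + (1 - t%:num) *: P2)).
Proof.
move=> s1 s2 f1 f2.
have := posdef_psdD (posdef_conv t f1 f2) (riccati_convex s1 s2).
by congr posdefmx; apply/matrixP=> i j; rewrite !mxlinE; ring.
Qed.

(** Serves [P_plus] with [(A, B)], and [P_minus] through its negative with [(- A, - B)]. *)
Lemma expansive_solution_concave P1 P2 P :
  expansive_solution A B Q1 S1 R1 P1 -> expansive_solution A B Q2 S2 R2 P2 ->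
  expansive_solution A B Q S R P ->
  possemidefmx (P - (t%:num *: P1 + (1 - t%:num) *: P2)).
Proof.
move=> [s1 e1 _] [s2 e2 _] [sP eP hP].
apply: (riccati_max negdef_conv sP _ eP hP); first by rewrite !trmx_lin s1 s2.
by have := riccati_convex s1 s2; rewrite e1 e2 !scaler0 addr0 sub0r.
Qed.

End Combination.

End AntistabilizingSolutions.

(** * The domain and the extremal solutions as functions of the parameter *)

Section ParametrizedSolutions.
Context {K : realType} {n m p : nat}.
Context (A : 'M[K]_n) (B : 'M[K]_(n, m)).
Context (Q : 'I_p.+1 -> 'M[K]_n) (S : 'I_p.+1 -> 'M[K]_(n, m)).
Context (R : 'I_p.+1 -> 'M[K]_m).
Hypotheses (Q_sym : forall i, Q i \is symmetricmx) (AB_ctrl : controllable A B).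

Let D := riccati_dom A B Q S R.
Let Pp := P_plus A B Q S R.
Let Pm := P_minus A B Q S R.
Let sol A' B' x P :=
  expansive_solution A' B' (affine_mx Q x) (affine_mx S x) (affine_mx R x) P.

Lemma dom_plus x : D x -> negdefmx (affine_mx R x) /\ sol A B x (Pp x).
Proof.
move=> [nR exP]; split; first exact: nR.
apply/(antistabilizingP _ _ _ _ _ nR).
(* On the domain a solution exists, so [xget] returns one and not its default 0. *)
exact: (@xgetPex _ 0 [set P | antistabilizing _ _ _ _ _ P]).
Qed.

Lemma dom_strictly_feasible x : D x -> exists2 P0, P0^T = P0 &
  posdefmx (- riccati A B (affine_mx Q x) (affine_mx S x) (affine_mx R x) P0).
Proof.
move=> /dom_plus[nR [sP eP hP]].
exact: (antistab_strictly_feasible nR sP eP hP).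
Qed.

(** With the preceding lemma this describes the domain as [R < 0] together with strict feasibility,
    a condition that passes to convex combinations; the spectral definition does not show this. *)
Lemma dom_of_strictly_feasible x P0 : negdefmx (affine_mx R x) -> P0^T = P0 ->
  posdefmx (- riccati A B (affine_mx Q x) (affine_mx S x) (affine_mx R x) P0) ->
  D x.
Proof.
move=> nR s0 f0; split; first exact: nR.
have [[F eF] _] := controllable_feedbacks AB_ctrl.
have [P hP] := riccati_expansive_solution (affine_mx_sym x Q_sym) nR eF s0 f0.
by exists P; apply/(antistabilizingP _ _ _ _ _ nR).
Qed.

(** Strict feasibility survives the change of sign of [A], [B] and [P], so the existence result
    applies to the reversed system as well. *)
Lemma dom_minus x : D x -> sol (- A) (- B) x (- Pm x).
Proof.
move=> Dx; have [nR _] := dom_plus Dx; have [P0 s0 f0] := dom_strictly_feasible Dx.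
apply/(antistabilizingP _ _ _ _ _ nR)/stabilizing_opp.
have [_ [F eF]] := controllable_feedbacks AB_ctrl.
have s0' : (- P0)^T = - P0 by rewrite trmx_opp s0.
move: f0; rewrite -riccati_opp => f0.
have [P hP] := riccati_expansive_solution (affine_mx_sym x Q_sym) nR eF s0' f0.
apply: (@xgetPex _ 0 [set P | stabilizing _ _ _ _ _ P]).
by exists (- P); apply/stabilizing_opp; rewrite opprK; apply/(antistabilizingP _ _ _ _ _ nR).
Qed.

Lemma dom_convex : convex_set D.
Proof.
move=> x y t /set_mem Dx /set_mem Dy; apply/mem_set.
have [[n1 _] [n2 _]] := (dom_plus Dx, dom_plus Dy).
have [P1 s1 f1] := dom_strictly_feasible Dx.
have [P2 s2 f2] := dom_strictly_feasible Dy.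
apply: (@dom_of_strictly_feasible _ (t%:num *: P1 + (1 - t%:num) *: P2)).
- by rewrite affine_mx_conv; exact: negdef_conv.
- by rewrite !trmx_lin s1 s2.
- by rewrite !affine_mx_conv; exact: strictly_feasible_conv.
Qed.

Lemma P_plus_concave (t : {i01 K}) x y : D x -> D y ->
  possemidefmx (Pp (conv t x y) - (t%:num *: Pp x + (1 - t%:num) *: Pp y)).
Proof.
move=> Dx Dy; have [[n1 h1] [n2 h2]] := (dom_plus Dx, dom_plus Dy).
have /dom_plus[_] : D (conv t x y) by apply/set_mem/dom_convex; apply/mem_set.
rewrite /sol !affine_mx_conv => h.
exact: (expansive_solution_concave n1 n2 h1 h2 h).
Qed.

Lemma P_minus_convex (t : {i01 K}) x y : D x -> D y ->
  possemidefmx (t%:num *: Pm x + (1 - t%:num) *: Pm y - Pm (conv t x y)).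
Proof.
move=> Dx Dy; have [[n1 _] [n2 _]] := (dom_plus Dx, dom_plus Dy).
have /dom_minus : D (conv t x y) by apply/set_mem/dom_convex; apply/mem_set.
rewrite /sol !affine_mx_conv => h.
have := expansive_solution_concave n1 n2 (dom_minus Dx) (dom_minus Dy) h.
move: (Pm x) (Pm y) (Pm _) => X Y Z.
by congr possemidefmx; apply/matrixP=> i j; rewrite !mxlinE; ring.
Qed.

(** A strictly feasible [P0] separates the two solutions: [P_minus <= P0 < P_plus]. *)
Lemma P_gap_posdef x : D x -> posdefmx (Pp x - Pm x).
Proof.
move=> Dx; have [nR [sp ep hp]] := dom_plus Dx; have [sm em hm] := dom_minus Dx.
have [P0 s0 f0] := dom_strictly_feasible Dx.
have s0' : (- P0)^T = - P0 by rewrite trmx_opp s0.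
have h1 := riccati_max_strict nR sp s0 ep hp f0.
move: f0; rewrite -riccati_opp => /posdef_psd f0.
have h2 := riccati_max nR sm s0' em hm f0.
have := posdef_psdD h1 h2.
by congr posdefmx; apply/matrixP=> i j; rewrite !mxlinE; ring.
Qed.

Lemma P_gap_concave (t : {i01 K}) x y : D x -> D y ->
  possemidefmx (Pp (conv t x y) - Pm (conv t x y) -
    (t%:num *: (Pp x - Pm x) + (1 - t%:num) *: (Pp y - Pm y))).
Proof.
move=> Dx Dy; have := psdD (P_plus_concave t Dx Dy) (P_minus_convex t Dx Dy).
move: (Pp x) (Pp y) (Pp _) (Pm x) (Pm y) (Pm _) => Xp Yp Zp Xm Ym Zm.
by congr possemidefmx; apply/matrixP=> i j; rewrite !mxlinE; ring.
Qed.

End ParametrizedSolutions.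

Theorem lemma3 (K : realType) (n m p : nat)
    (n_gt0 : (0 < n)%N) (m_gt0 : (0 < m)%N) (p_gt0 : (0 < p)%N)
    (A : 'M[K]_n) (B : 'M[K]_(n, m)) (Sigma : 'M[K]_n)
    (Q : 'I_p.+1 -> 'M[K]_n) (S : 'I_p.+1 -> 'M[K]_(n, m))
    (R : 'I_p.+1 -> 'M[K]_m)
    (Q_sym : forall i, Q i \is symmetricmx)
    (R_sym : forall i, R i \is symmetricmx)
    (AB_ctrl : controllable A B)
    (Sigma_ge0 : possemidefmx Sigma) :
  let D := riccati_dom A B Q S R in
  let Pp := P_plus A B Q S R in
  let Pm := P_minus A B Q S R in
  let Delta := P_gap A B Q S R in
  [/\ convex_mxmap D Pm,
      concave_mxmap D Pp,
      convex_realmap (D `&` [set lam | posdefmx (Pp lam)])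
        (fun lam => - ln (\det (Pp lam))),
      convex_realmap D (fun lam => - ln (\det (Delta lam)))
    & convex_realmap D (fun lam => - \tr (Sigma *m Pp lam))].
Proof.
move=> D Pp Pm Delta.
have cD : convex_set D by exact: dom_convex.
have convD t x y : x \in D -> y \in D -> D (conv t x y).
  by move=> Dx Dy; apply/set_mem; exact: cD.
(* Passes from concavity inequalities to convexity of the negatives; [conv] on [K^o] unfolds to the
   weighted mean. *)
have conv_opp (t : {i01 K}) (a b c : K) :
    t%:num * a + (1 - t%:num) * b <= c -> - c <= conv t (- a : K^o) (- b : K^o).
  move=> h; change (- c <= t%:num * - a + (1 - t%:num) * - b).
  by move: h; clear; lra.
have t01 (t : {i01 K}) : 0 <= t%:num <= 1 by apply/andP.
split.
- split=> // t x y /set_mem Dx /set_mem Dy.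
  exact (P_minus_convex Q_sym AB_ctrl t Dx Dy).
- split=> // t x y /set_mem Dx /set_mem Dy.
  exact (P_plus_concave Q_sym AB_ctrl t Dx Dy).
(* By concavity, [P_plus] at the combination dominates a mean of positive definite matrices, so the
   restricted domain is convex too. *)
- have pos t x y : D x -> D y -> posdefmx (Pp x) -> posdefmx (Pp y) ->
      posdefmx (Pp (conv t x y)).
    move=> Dx Dy px py.
    have := posdef_psdD (posdef_conv t px py) (P_plus_concave Q_sym AB_ctrl t Dx Dy).
    by rewrite addrC subrK.
  split=> [x y t /set_mem[Dx px] /set_mem[Dy py]|t x y /set_mem[Dx px] /set_mem[Dy py]].
    apply: mem_set; split; last exact (pos t _ _ Dx Dy px py).
    exact (convD t _ _ (mem_set Dx) (mem_set Dy)).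
  apply: conv_opp; exact (ln_det_concave (t01 t) px py (pos t _ _ Dx Dy px py)
    (P_plus_concave Q_sym AB_ctrl t Dx Dy)).
- split=> // t x y Dx Dy; have Dc := convD t _ _ Dx Dy.
  move: Dx Dy => /set_mem Dx /set_mem Dy.
  apply: conv_opp; exact (ln_det_concave (t01 t) (P_gap_posdef Q_sym AB_ctrl Dx)
    (P_gap_posdef Q_sym AB_ctrl Dy) (P_gap_posdef Q_sym AB_ctrl Dc)
    (P_gap_concave Q_sym AB_ctrl t Dx Dy)).
- split=> // t x y /set_mem Dx /set_mem Dy.
  apply: conv_opp.
  have := trace_psd_psd Sigma_ge0 (P_plus_concave Q_sym AB_ctrl t Dx Dy).
  rewrite -/Pp; move: (Pp x) (Pp y) (Pp _) => X Y Z.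
  by rewrite mulmxBr mulmxDr -!scalemxAr [\tr (_ - _)]raddfB /= mxtraceD !mxtraceZ subr_ge0.
Qed.
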